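(* Let $N$ be a positive integer, $a$ a positive real number, and let $s$ be an arbitrary real number such that $s\neq 1$ and $s>1-2N$. Then $$R_N(s,a)=\frac{B_{2N}}{(2N)!}\frac{(s)_{2N-1}}{a^{2N}}\,\theta_N(s,a),$$ where $0<\theta_N(s,a)<1$ is a suitable number that depends on $s$, $a$ and $N$.
   Context: $\zeta(s,a)$ is the Hurwitz zeta function: $\zeta(s,a)=\sum_{n=0}^\infty (n+a)^{-s}$ for $\Re(s)>1$, $a\notin\mathbb{Z}_{\le 0}$, continued meromorphically in $s$ (only a simple pole at $s=1$). $B_{2n}$ are the even-order Bernoulli numbers and $(w)_p=\Gamma(w+p)/\Gamma(w)$ is the Pochhammer symbol (for integer $p\ge1$ it is the polynomial $w(w+1)\cdots(w+p-1)$). For $|\arg a|<\pi$, $s\neq 1$ and a positive integer $N$, the remainder $R_N(s,a)$ is defined by $$\zeta(s,a)=\frac12 a^{-s}+\frac{a^{1-s}}{s-1}+a^{1-s}\left(\sum_{n=1}^{N-1}\frac{B_{2n}}{(2n)!}\frac{(s)_{2n-1}}{a^{2n}}+R_N(s,a)\right),$$ empty sums being zero and powers of $a$ being principal. *)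

(* Defs.v *)
From Stdlib Require Import Reals Lra Lia Arith ClassicalEpsilon.
From Coquelicot Require Import Coquelicot.
Open Scope R_scope.

Definition Cexp (z : C) : C := (exp (Re z) * cos (Im z), exp (Re z) * sin (Im z)).

(* Principal argument, with values in (-PI, PI]; meaningful for z <> 0 only. *)
Definition Carg (z : C) : R :=
  if Rle_dec 0 (Im z) then acos (Re z / Cmod z) else - acos (Re z / Cmod z).

Definition Clog (z : C) : C := (ln (Cmod z), Carg z).

(* Principal power z^w, for z <> 0. *)
Definition Cpower (z w : C) : C := Cexp (w * Clog z).

Definition analytic_at (f : C -> C) (z0 : C) : Prop :=
  exists (c : nat -> C) (r : posreal),
    forall z : C, Cmod (z - z0) < r -> is_pseries c (z - z0)%C (f z).

Definition simple_pole_at (f : C -> C) (z0 : C) : Prop :=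
  exists g : C -> C,
    analytic_at g z0 /\ g z0 <> RtoC 0 /\
    exists r : posreal, forall z : C,
      z <> z0 -> Cmod (z - z0) < r -> f z = (g z / (z - z0))%C.

(* Since C \ {1} is connected, this determines f on C \ {1}; the value of f at
   the pole 1 is left unspecified. *)
Definition is_hurwitz_zeta (a : C) (f : C -> C) : Prop :=
  (forall s : C, 1 < Re s ->
     is_series (fun n : nat => Cpower (RtoC (INR n) + a) (- s)) (f s)) /\
  (forall s : C, s <> RtoC 1 -> analytic_at f s) /\
  simple_pole_at f (RtoC 1).

(* Meaningful when s <> 1 and a is not one of 0, -1, -2, ... *)
Definition hurwitz_zeta (s a : C) : C :=
  epsilon (inhabits (fun _ : C => RtoC 0)) (is_hurwitz_zeta a) s.

(* bernoulli_upto n k is the k-th Bernoulli number for k <= n. *)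
Fixpoint bernoulli_upto (n : nat) : nat -> R :=
  match n with
  | O => fun _ => 1
  | S m => fun k =>
      if (k <=? m)%nat then bernoulli_upto m k
      else - sum_f_R0 (fun j => Binomial.C (m + 2) j * bernoulli_upto m j) m
           / INR (m + 2)
  end.

Definition bernoulli (n : nat) : R := bernoulli_upto n n.

Lemma bernoulli_upto_eq (n k : nat) :
  (k <= n)%nat -> bernoulli_upto n k = bernoulli k.
Proof.
induction n as [|n IH]; intros Hk.
- now replace k with O by lia.
- destruct (Nat.eq_dec k (S n)) as [->|Hne]; [reflexivity|].
  simpl. destruct (Nat.leb_spec k n); [apply IH; lia | lia].
Qed.

Lemma bernoulli_0 : bernoulli 0 = 1.
Proof. reflexivity. Qed.

(* The usual recurrence, that is t = (exp t - 1) * sum_k B_k t^k / k!. *)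
Lemma bernoulli_rec (n : nat) : (1 <= n)%nat ->
  sum_f_R0 (fun k => Binomial.C (n + 1) k * bernoulli k) n = 0.
Proof.
intros Hn; destruct n as [|m]; [lia|]; clear Hn.
rewrite tech5.
assert (HC : Binomial.C (S m + 1) (S m) = INR (m + 2)).
{ replace (S m + 1)%nat with (S (S m)) by lia.
  unfold Binomial.C. replace (S (S m) - S m)%nat with 1%nat by lia.
  rewrite (fact_simpl (S m)), mult_INR.
  replace (m + 2)%nat with (S (S m)) by lia.
  change (INR (fact 1)) with 1.
  field. apply INR_fact_neq_0. }
rewrite HC. unfold bernoulli at 2. cbn [bernoulli_upto].
replace (S m <=? m)%nat with false by (symmetry; apply Nat.leb_gt; lia).
replace (S m + 1)%nat with (m + 2)%nat by lia.
rewrite (sum_eq (fun j => Binomial.C (m + 2) j * bernoulli_upto m j)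
                (fun k => Binomial.C (m + 2) k * bernoulli k)).
- field. apply not_0_INR; lia.
- intros i Hi. now rewrite bernoulli_upto_eq.
Qed.

(* w (w + 1) ... (w + p - 1) *)
Fixpoint pochhammer (w : C) (p : nat) : C :=
  match p with
  | O => RtoC 1
  | S q => (pochhammer w q * (w + RtoC (INR q)))%C
  end.

(* B_{2n} / (2n)! * (s)_{2n-1} / a^{2n}, for n >= 1 *)
Definition em_term (s a : C) (n : nat) : C :=
  (RtoC (bernoulli (2 * n) / INR (fact (2 * n)))
   * (pochhammer s (2 * n - 1) / a ^ (2 * n)))%C.

(* The defining equation, solved for R_N(s, a): see hurwitz_remainder_eq.
   Meaningful for s <> 1, |arg a| < PI and N >= 1.  The sum over n = 1 .. N - 1
   is empty when N = 1. *)
Definition hurwitz_remainder (N : nat) (s a : C) : C :=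
  ((hurwitz_zeta s a
    - (RtoC (1 / 2) * Cpower a (- s) + Cpower a (RtoC 1 - s) / (s - RtoC 1)))
   / Cpower a (RtoC 1 - s)
   - sum_n_m (em_term s a) 1 (N - 1))%C.

Lemma Cexp_neq_0 (z : C) : Cexp z <> RtoC 0.
Proof.
unfold Cexp; intros H; injection H as H1 H2.
pose proof (exp_pos (Re z)) as He.
pose proof (sin2_cos2 (Im z)) as Hsc.
apply Rmult_integral in H1; apply Rmult_integral in H2.
destruct H1 as [H1|H1], H2 as [H2|H2]; try lra.
unfold Rsqr in Hsc; rewrite H1, H2 in Hsc; lra.
Qed.

Lemma hurwitz_remainder_eq (N : nat) (s a : C) : s <> RtoC 1 ->
  hurwitz_zeta s a =
  (RtoC (1 / 2) * Cpower a (- s) + Cpower a (RtoC 1 - s) / (s - RtoC 1)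
   + Cpower a (RtoC 1 - s)
     * (sum_n_m (em_term s a) 1 (N - 1) + hurwitz_remainder N s a))%C.
Proof.
intros Hs. unfold hurwitz_remainder.
assert (Hp : Cpower a (RtoC 1 - s) <> RtoC 0) by apply Cexp_neq_0.
assert (Hs1 : (s - RtoC 1)%C <> RtoC 0)
  by (intros H; apply Hs; replace s with ((s - RtoC 1) + RtoC 1)%C by ring;
      rewrite H; ring).
set (S := sum_n_m _ _ _ : C). field. split; assumption.
Qed.

(* Main.v *)
Require Import Defs.
From Stdlib Require Import Reals Arith Lra Lia Classical ClassicalEpsilon.
From Coquelicot Require Import Coquelicot.
Open Scope R_scope.

(** Put [w = s - 1].  Integrating by parts against Bernoulli polynomials expresses
    [w * x ^ (- w - 1)], for every order [m], as the difference at [x] and [x + 1]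
    of the finite expansion [em_sum m w], minus [rpoch w (m + 1)] times an integral
    over [[x, x + 1]] that is of size [x ^ (- w - m - 1)] ([em_step]).  Summing over
    [x = n + a] gives, in order [m + 1], a function [em_value a m w] for
    [- m - 1 < w], which does not depend on the order where two orders are both
    meaningful ([em_value_indep]), and equals [w * zeta(1 + w, a)] for [0 < w].

    To identify it with the analytic continuation, the Taylor coefficients at
    [w = 0] are bounded: the integrands are powers [y ^ (- w)], whose Taylor
    remainders in [w] are controlled by a geometric factor times slightly larger
    powers.  As the order is arbitrary, the radius of convergence is infinite, so
    one real sequence of coefficients defines an entire function, and dividing it by
    [z - 1] gives a function on the complex plane ([zeta_of_coefs]).  It agrees with
    the Dirichlet series on each disc that is centred at a real point and contained
    in the half-plane of abscissa 1, because there both are power series that agree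
    on real points.  Hence a continuation exists, and the one that is picked by
    choice has the same values at real points other than 1: a power series that
    vanishes on one side of its centre vanishes, and this propagates along the real
    line from the half-line of convergence, through the pole, to the left
    ([hurwitz_zeta_unique_on_reals]).

    It remains to locate the real remainder, here multiplied by [w * a ^ (- w)].
    With the constant of integration chosen so that the kernel vanishes at both ends,
    the remainder of index [N] is [rpoch w (2 N + 1)] times a convergent sum of
    integrals of powers against the kernel [B_(2N) - B_(2N)(t)], divided by [(2N)!],
    which has the strict sign of [(-1) ^ (N - 1)] on the open interval
    ([em_kernel_sign]).  Since [- 2 N < w], the products [rpoch w (2 N + 1)] and
    [rpoch w (2 N + 3)] are positive multiples of [rpoch w (2 N)].  So either these
    products all vanish, and with them the remainder and the term of index [N], or
    the remainders of index [N] and [N + 1] have strictly opposite signs.  Their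
    difference is the term of index [N], and the remainder of index [N] is therefore
    a fraction strictly between 0 and 1 of that term ([em_remainder_fraction]). *)

(** * Bernoulli polynomials *)

Definition bern_coef (k : nat) : R := bernoulli k / INR (fact k).

(** The Bernoulli polynomial divided by [k!], which makes differentiation lower the
    index without a factor. *)
Definition bern_poly (k : nat) (t : R) : R :=
  sum_f_R0 (fun j => bern_coef (k - j) * (t ^ j / INR (fact j))) k.

Lemma bern_coef_0 : bern_coef 0 = 1.
Proof. unfold bern_coef, bernoulli. simpl. field. Qed.

Lemma bern_coef_1 : bern_coef 1 = - (1 / 2).
Proof. unfold bern_coef, bernoulli. simpl. unfold Binomial.C. simpl. field. Qed.

Lemma is_derive_sum_f_R0 (f df : nat -> R -> R) (n : nat) (x : R) :
  (forall k, (k <= n)%nat -> is_derive (f k) x (df k x)) ->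
  is_derive (fun t => sum_f_R0 (fun k => f k t) n) x
            (sum_f_R0 (fun k => df k x) n).
Proof.
induction n as [|n IH]; intros H.
- apply H; lia.
- apply (is_derive_plus (fun t => sum_f_R0 (fun k => f k t) n) (f (S n))).
  + apply IH; intros; apply H; lia.
  + apply H; lia.
Qed.

Lemma bern_poly_0 (k : nat) : bern_poly k 0 = bern_coef k.
Proof.
unfold bern_poly. destruct k as [|k].
- simpl. field.
- rewrite decomp_sum by lia. simpl (pred (S k)).
  rewrite (sum_eq _ (fun _ => 0)).
  + rewrite sum_cte. simpl. field.
  + intros i Hi. simpl (0 ^ S i). unfold Rdiv. ring.
Qed.

Lemma bern_poly_succ (k : nat) (t : R) :
  bern_poly (S k) t =
  bern_coef (S k)
  + sum_f_R0 (fun j => bern_coef (k - j) * (t ^ S j / INR (fact (S j)))) k.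
Proof.
unfold bern_poly. rewrite decomp_sum by lia. simpl (pred (S k)).
f_equal. simpl. field.
Qed.

Lemma is_derive_bern_poly_succ (k : nat) (t : R) :
  is_derive (bern_poly (S k)) t (bern_poly k t).
Proof.
apply is_derive_ext with (f := fun t => bern_coef (S k) + sum_f_R0
   (fun j => bern_coef (k - j) * (t ^ S j / INR (fact (S j)))) k).
{ intros u. now rewrite bern_poly_succ. }
replace (bern_poly k t) with (0 + bern_poly k t) by ring.
apply (is_derive_plus (fun _ => bern_coef (S k))).
{ apply @is_derive_const. }
apply (is_derive_sum_f_R0
  (fun j t => bern_coef (k - j) * (t ^ S j / INR (fact (S j))))
  (fun j t => bern_coef (k - j) * (t ^ j / INR (fact j)))).
intros j _. pose proof (INR_fact_neq_0 j) as Hj.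
pose proof (INR_fact_neq_0 (S j)) as Hj'.
auto_derive; [easy|].
change (match j with O => 1 | S _ => INR j + 1 end) with (INR (S j)).
change (fact j + j * fact j)%nat with (fact (S j)).
rewrite fact_simpl, mult_INR in *. field. split; [easy|].
apply not_0_INR; lia.
Qed.

Lemma is_derive_bern_poly_0 (t : R) : is_derive (bern_poly 0) t 0.
Proof.
apply is_derive_ext with (f := fun _ => bern_coef 0).
{ intros u. unfold bern_poly; simpl; field. }
apply @is_derive_const.
Qed.

Lemma sum_f_R0_rev (f : nat -> R) (n : nat) :
  sum_f_R0 (fun j => f (n - j)%nat) n = sum_f_R0 f n.
Proof.
induction n as [|n IH]; [reflexivity|].
rewrite decomp_sum by lia. simpl (pred (S n)).
rewrite tech5, <- IH, Nat.sub_0_r. apply Rplus_comm.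
Qed.

(** At 1 the polynomial is the full binomial sum, and the recurrence of the
    Bernoulli numbers cancels all but its last term. *)
Lemma bern_poly_1_of_ge_2 (k : nat) : bern_poly (S (S k)) 1 = bern_coef (S (S k)).
Proof.
rewrite bern_poly_succ.
rewrite (sum_eq _ (fun j => (Binomial.C (S k + 1) (S k - j) * bernoulli (S k - j))
                     * / INR (fact (S (S k))))).
2:{ intros j Hj. unfold bern_coef, Binomial.C.
    replace (S k + 1 - (S k - j))%nat with (S j) by lia.
    replace (S k + 1)%nat with (S (S k)) by lia.
    rewrite pow1. field. repeat split; apply INR_fact_neq_0. }
rewrite <- scal_sum.
replace (sum_f_R0 _ (S k)) with 0; [ring|]. symmetry.
rewrite <- (bernoulli_rec (S k)) by lia.
apply (sum_f_R0_rev (fun i => Binomial.C (S k + 1) i * bernoulli i)).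
Qed.

(** By induction both sides have the same derivative, so they differ by a constant.
    In degree 1 the value at 1/2 shows that it is 0.  In higher degree it is, up to
    sign, the increment over [[0, 1]] of the next difference, which is 0 because the
    next polynomial has equal values at 0 and 1. *)
Lemma bern_poly_symm (k : nat) (t : R) :
  bern_poly k (1 - t) = (-1) ^ k * bern_poly k t.
Proof.
revert t. induction k as [|k IH]; intros t.
- unfold bern_poly. simpl. ring.
- set (g := fun t => (-1) ^ S k * bern_poly (S k) (1 - t) - bern_poly (S k) t).
  assert (Hsq : forall m, (-1) ^ m * (-1) ^ m = 1).
  { intros m. rewrite <- Rpow_mult_distr.
    replace (-1 * -1) with 1 by ring. apply pow1. }
  assert (Hg : forall t, is_derive g t 0).
  { intros u. unfold g.
    replace 0 with ((-1) ^ S k * (-1 * bern_poly k (1 - u)) - bern_poly k u).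
    2:{ rewrite IH. simpl.
        transitivity (((-1) ^ k * (-1) ^ k - 1) * bern_poly k u); [ring|].
        rewrite Hsq. ring. }
    apply (is_derive_minus (fun t => (-1) ^ S k * bern_poly (S k) (1 - t))).
    - apply is_derive_scal.
      apply (is_derive_comp (bern_poly (S k)) (fun t => 1 - t)).
      + apply is_derive_bern_poly_succ.
      + auto_derive; [easy|ring].
    - apply is_derive_bern_poly_succ. }
  assert (Hc : forall u v, g u = g v).
  { intros u v. destruct (Rtotal_order u v) as [H|[->|H]]; [|easy|symmetry];
    apply eq_is_derive; try easy; intros; apply Hg. }
  assert (Hg0 : g t = 0).
  { destruct k as [|k].
    - rewrite (Hc t (1 / 2)). unfold g, bern_poly. simpl.
      rewrite bern_coef_0, bern_coef_1. field.
    - (* Since [g] is constant, [G] has derivative 0; its values at 0 and 1 then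
         give the equation that determines [g]. *)
      set (G := fun t => - ((-1) ^ S (S k) * bern_poly (S (S (S k))) (1 - t))
                         - bern_poly (S (S (S k))) t - g t * t).
      assert (HG : forall t, is_derive G t 0).
      { intros u. unfold G.
        apply is_derive_ext with (f := fun t =>
          - ((-1) ^ S (S k) * bern_poly (S (S (S k))) (1 - t))
            - bern_poly (S (S (S k))) t - g u * t).
        { intros v. now rewrite (Hc u v). }
        replace 0 with (- ((-1) ^ S (S k) * (-1 * bern_poly (S (S k)) (1 - u)))
          - bern_poly (S (S k)) u - g u) by (unfold g; ring).
        apply (is_derive_minus (fun t =>
          - ((-1) ^ S (S k) * bern_poly (S (S (S k))) (1 - t))
            - bern_poly (S (S (S k))) t) (fun t => g u * t)).
        - apply (is_derive_minus (fun t =>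
            - ((-1) ^ S (S k) * bern_poly (S (S (S k))) (1 - t)))).
          + apply (is_derive_opp (fun t =>
              (-1) ^ S (S k) * bern_poly (S (S (S k))) (1 - t))).
            apply is_derive_scal.
            apply (is_derive_comp (bern_poly (S (S (S k)))) (fun t => 1 - t)).
            * apply is_derive_bern_poly_succ.
            * auto_derive; [easy|ring].
          + apply is_derive_bern_poly_succ.
        - auto_derive; [easy|ring]. }
      assert (H01 : G 0 = G 1) by (apply eq_is_derive; [intros; apply HG|lra]).
      unfold G in H01.
      rewrite Rminus_0_r, Rminus_diag, bern_poly_0, bern_poly_1_of_ge_2 in H01.
      rewrite (Hc t 1). lra. }
  unfold g in Hg0.
  transitivity ((-1) ^ S k * ((-1) ^ S k * bern_poly (S k) (1 - t))).
  + rewrite <- Rmult_assoc, Hsq. ring.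
  + f_equal. lra.
Qed.

Lemma bern_poly_1 (k : nat) : bern_poly k 1 = (-1) ^ k * bern_coef k.
Proof. rewrite <- bern_poly_0, <- bern_poly_symm. f_equal; ring. Qed.

Lemma pow_m1_odd (N : nat) : (-1) ^ S (2 * N) = -1.
Proof. now rewrite pow_1_odd. Qed.

Lemma bern_coef_odd (N : nat) : bern_coef (2 * N + 3) = 0.
Proof.
pose proof (bern_poly_1 (2 * N + 3)) as H.
replace (2 * N + 3)%nat with (S (2 * S N)) in H |- * by lia.
rewrite pow_m1_odd in H.
replace (S (2 * S N))%nat with (S (S (2 * N + 1))) in H |- * by lia.
rewrite bern_poly_1_of_ge_2 in H. lra.
Qed.

Lemma bern_poly_odd_half (N : nat) : bern_poly (S (2 * N)) (1 / 2) = 0.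
Proof.
pose proof (bern_poly_symm (S (2 * N)) (1 / 2)) as H.
rewrite pow_m1_odd in H. replace (1 - 1 / 2) with (1 / 2) in H by field. lra.
Qed.

(** A nonnegative value inside would force a nonnegative slope to its left and a
    nonpositive slope to its right. *)
Lemma strictly_convex_neg_inside (g g' g'' : R -> R) (a b : R) :
  (forall t, is_derive g t (g' t)) -> (forall t, is_derive g' t (g'' t)) ->
  (forall t, a < t < b -> 0 < g'' t) -> g a = 0 -> g b = 0 ->
  forall t, a < t < b -> g t < 0.
Proof.
intros H1 H2 Hpos Ha Hb t Ht.
destruct (MVT_cor2 g g' a t) as [c [Hc Hc']]; [lra|intros; apply is_derive_Reals, H1|].
destruct (MVT_cor2 g g' t b) as [d [Hd Hd']]; [lra|intros; apply is_derive_Reals, H1|].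
destruct (MVT_cor2 g' g'' c d) as [e [He He']]; [lra|intros; apply is_derive_Reals, H2|].
assert (0 < g'' e * (d - c)) by (apply Rmult_lt_0_compat; [apply Hpos|]; lra).
apply Rnot_le_lt. intros Hge.
assert (0 <= g' c).
{ apply Rmult_le_reg_r with (t - a); lra. }
assert (g' d <= 0).
{ apply Rmult_le_reg_r with (b - t); lra. }
lra.
Qed.

(** The second derivative is the previous odd polynomial, and from degree 3
    on 0 and 1/2 are zeros: the sign alternates by convexity. *)
Lemma bern_poly_odd_sign (N : nat) (t : R) :
  0 < t < 1 / 2 -> 0 < (-1) ^ S N * bern_poly (S (2 * N)) t.
Proof.
revert t. induction N as [|N IH]; intros t Ht.
- unfold bern_poly. simpl. rewrite bern_coef_0, bern_coef_1. lra.
- replace (S (2 * S N)) with (S (S (S (2 * N)))) by lia.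
  apply Ropp_lt_cancel. rewrite Ropp_0.
  replace (- ((-1) ^ S (S N) * bern_poly (S (S (S (2 * N)))) t))
    with ((-1) ^ S N * bern_poly (S (S (S (2 * N)))) t) by (simpl; ring).
  apply (strictly_convex_neg_inside
    (fun t => (-1) ^ S N * bern_poly (S (S (S (2 * N)))) t)
    (fun t => (-1) ^ S N * bern_poly (S (S (2 * N))) t)
    (fun t => (-1) ^ S N * bern_poly (S (2 * N)) t) 0 (1 / 2)); try easy.
  + intros u. apply is_derive_scal, is_derive_bern_poly_succ.
  + intros u. apply is_derive_scal, is_derive_bern_poly_succ.
  + rewrite bern_poly_0.
    replace (S (S (S (2 * N)))) with (2 * N + 3)%nat by lia.
    rewrite bern_coef_odd. ring.
  + replace (S (S (S (2 * N)))) with (S (2 * S N)) by lia.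
    rewrite bern_poly_odd_half. ring.
Qed.

(** The constant makes the kernel vanish at 0 and 1. *)
Definition em_kernel (N : nat) (t : R) : R :=
  bern_coef (S (S (2 * N))) - bern_poly (S (S (2 * N))) t.

(** The kernel is 0 at 0, and up to 1/2 its derivative is the opposite of an odd
    Bernoulli polynomial, of constant sign there; the other half follows by
    reflection. *)
Lemma em_kernel_sign (N : nat) (t : R) :
  0 < t < 1 -> 0 < (-1) ^ N * em_kernel N t.
Proof.
assert (Hhalf : forall t, 0 < t <= 1 / 2 -> 0 < (-1) ^ N * em_kernel N t).
{ intros u Hu.
  destruct (MVT_cor2 (bern_poly (S (S (2 * N)))) (bern_poly (S (2 * N))) 0 u)
    as [c [Hc Hc']]; [lra|intros; apply is_derive_Reals, is_derive_bern_poly_succ|].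
  rewrite bern_poly_0 in Hc. unfold em_kernel.
  replace ((-1) ^ N * (bern_coef (S (S (2 * N))) - bern_poly (S (S (2 * N))) u))
    with ((-1) ^ S N * bern_poly (S (2 * N)) c * u).
  2:{ replace (bern_coef (S (S (2 * N))) - bern_poly (S (S (2 * N))) u)
        with (- (bern_poly (S (2 * N)) c * (u - 0))) by lra. simpl. ring. }
  apply Rmult_lt_0_compat; [apply bern_poly_odd_sign|]; lra. }
intros Ht. destruct (Rle_dec t (1 / 2)) as [H|H].
- apply Hhalf; lra.
- replace (em_kernel N t) with (em_kernel N (1 - t)); [apply Hhalf; lra|].
  unfold em_kernel. rewrite bern_poly_symm.
  replace (S (S (2 * N))) with (2 * S N)%nat by lia.
  rewrite pow_1_even. ring.
Qed.

(** * Convergence of complex series and power series *)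

Lemma sum_n_Re (u : nat -> C) (n : nat) :
  Re (sum_n u n) = sum_n (fun k => Re (u k)) n.
Proof.
induction n as [|n IH]; [now rewrite !sum_O|].
rewrite !sum_Sn, <- IH. reflexivity.
Qed.

Lemma sum_n_Im (u : nat -> C) (n : nat) :
  Im (sum_n u n) = sum_n (fun k => Im (u k)) n.
Proof.
induction n as [|n IH]; [now rewrite !sum_O|].
rewrite !sum_Sn, <- IH. reflexivity.
Qed.

Lemma is_series_C_iff (u : nat -> C) (l : C) :
  is_series u l <->
  is_series (fun n => Re (u n)) (Re l) /\ is_series (fun n => Im (u n)) (Im l).
Proof.
unfold is_series. split.
- intros H; split; apply filterlim_locally; intros eps;
  pose proof (proj1 (filterlim_locally _ _) H eps) as H';
  revert H'; apply filter_imp; intros n [H1 H2].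
  + rewrite <- sum_n_Re. exact H1.
  + rewrite <- sum_n_Im. exact H2.
- intros [H1 H2]. apply filterlim_locally; intros eps.
  pose proof (proj1 (filterlim_locally _ _) H1 eps) as H3.
  pose proof (proj1 (filterlim_locally _ _) H2 eps) as H4.
  generalize (filter_and _ _ H3 H4). apply filter_imp. intros n [H5 H6].
  rewrite <- sum_n_Re in H5. rewrite <- sum_n_Im in H6.
  split; [exact H5|exact H6].
Qed.

Definition CSeries (u : nat -> C) : C :=
  (Series (fun n => Re (u n)), Series (fun n => Im (u n))).

Lemma is_series_CSeries (u : nat -> C) (l : C) : is_series u l -> CSeries u = l.
Proof.
intros [H1 H2]%is_series_C_iff. unfold CSeries.
rewrite (is_series_unique _ _ H1), (is_series_unique _ _ H2).
now destruct l.
Qed.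

Lemma is_series_unique_C (u : nat -> C) (l l' : C) :
  is_series u l -> is_series u l' -> l = l'.
Proof. intros H H'. rewrite <- (is_series_CSeries _ _ H). now apply is_series_CSeries. Qed.

Lemma is_series_zero {K : AbsRing} {V : NormedModule K} :
  is_series (fun _ : nat => (zero : V)) zero.
Proof.
unfold is_series. apply filterlim_ext with (f := fun _ => (zero : V)).
- intros n. induction n as [|n IH]; [now rewrite sum_O|].
  now rewrite sum_Sn, <- IH, plus_zero_l.
- apply filterlim_const.
Qed.

Lemma is_series_RtoC (u : nat -> R) (l : R) :
  is_series u l -> is_series (fun n => RtoC (u n)) (RtoC l).
Proof.
intros H. apply is_series_C_iff. split; [exact H|].
apply (is_series_zero (V := R_NormedModule)).
Qed.

Lemma norm_series_le {K : AbsRing} {V : NormedModule K}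
  (f : nat -> V) (g : nat -> R) (l : V) (L : R) :
  (forall n, norm (f n) <= g n) -> is_series f l -> is_series g L -> norm l <= L.
Proof.
intros Hfg Hf Hg.
apply (filterlim_le (F := eventually) (fun N => norm (sum_n f N)) (sum_n g)
  (Finite (norm l)) (Finite L)).
- exists O. intros n _.
  eapply Rle_trans; [apply norm_sum_n_m|]. apply sum_n_m_le, Hfg.
- eapply filterlim_comp; [apply Hf|apply filterlim_norm].
- exact Hg.
Qed.

(** The partial sums of the candidate power series are the sums of the Taylor
    polynomials of the terms, so a geometric bound on the Taylor remainders that
    is summable over the terms replaces an interchange of two infinite sums. *)
Lemma is_pseries_sum_of_remainders {K : AbsRing} {V : NormedModule K}
  (phi : nat -> V) (l : V) (d : nat -> nat -> V) (e : nat -> V) (u : K)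
  (M : nat -> R) (rho : R) :
  is_series phi l -> ex_series M -> 0 <= rho < 1 ->
  (forall k, is_series (fun n => d n k) (e k)) ->
  (forall n m, norm (minus (phi n) (sum_n (fun k => scal (pow_n u k) (d n k)) m))
               <= M n * rho ^ m) ->
  is_pseries e u l.
Proof.
intros Hl [L HM] Hrho He Hrem.
assert (HT : forall m, is_series (fun n => sum_n (fun k => scal (pow_n u k) (d n k)) m)
                                 (sum_n (fun k => scal (pow_n u k) (e k)) m)).
{ induction m as [|m IH].
  - rewrite sum_O. apply is_series_ext with (a := fun n => scal (pow_n u 0) (d n O)).
    { intros n. now rewrite sum_O. }
    apply is_series_scal, He.
  - rewrite sum_Sn. apply is_series_ext with (a := fun n =>
      plus (sum_n (fun k => scal (pow_n u k) (d n k)) m)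
           (scal (pow_n u (S m)) (d n (S m)))).
    { intros n. now rewrite sum_Sn. }
    apply is_series_plus; [exact IH|]. apply is_series_scal, He. }
assert (Hdiff : forall m,
  norm (minus l (sum_n (fun k => scal (pow_n u k) (e k)) m)) <= L * rho ^ m).
{ intros m.
  apply norm_series_le with (g := fun n => M n * rho ^ m)
    (f := fun n => minus (phi n) (sum_n (fun k => scal (pow_n u k) (d n k)) m)).
  - intros n. apply Hrem.
  - apply is_series_minus; [exact Hl|apply HT].
  - apply is_series_scal_r, HM. }
unfold is_pseries, is_series. apply filterlim_locally_ball_norm. intros eps.
assert (Hlim : is_lim_seq (fun m => L * rho ^ m) 0).
{ replace (Finite 0) with (Rbar_mult L 0) by (simpl; f_equal; ring).
  apply is_lim_seq_scal_l, is_lim_seq_geom. rewrite Rabs_pos_eq; lra. }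
apply is_lim_seq_spec in Hlim. specialize (Hlim eps). revert Hlim.
apply filter_imp. intros m Hm. unfold ball_norm.
rewrite <- norm_opp, opp_minus.
eapply Rle_lt_trans; [apply Hdiff|].
eapply Rle_lt_trans; [apply Rle_abs|]. now rewrite Rminus_0_r in Hm.
Qed.

(** * Uniqueness of coefficients and the identity theorem on a line *)

(** The sum is continuous at its centre, so values on one side determine it there. *)
Lemma pseries_zero_right_coef_0 (c : nat -> R) (r : R) :
  0 < r -> (forall t, 0 < t < r -> is_pseries c t 0) -> c O = 0.
Proof.
intros Hr H.
assert (Hcv : Rbar_lt (Rabs 0) (CV_radius c)).
{ apply Rbar_lt_le_trans with (Rabs (r / 2)).
  - simpl. rewrite Rabs_R0, Rabs_pos_eq; lra.
  - apply Rbar_not_lt_le. intros Hlt. apply CV_disk_outside in Hlt. apply Hlt.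
    assert (Hh : is_pseries c (r / 2) 0) by (apply H; lra).
    apply ex_series_lim_0. exists 0.
    apply is_pseries_R. exact Hh. }
pose proof (PSeries_continuity c 0 Hcv) as Hcont.
rewrite <- PSeries_0.
apply continuity_pt_filterlim in Hcont.
apply (filterlim_locally_unique (F := at_right 0) (PSeries c)).
- eapply filterlim_filter_le_1; [|apply Hcont].
  intros P HP. now apply filter_le_within.
- apply filterlim_ext_loc with (f := fun _ => 0); [|apply filterlim_const].
  exists (mkposreal r Hr). intros t Ht Ht0. symmetry.
  apply is_pseries_unique, H. split; [easy|].
  unfold ball in Ht. simpl in Ht. unfold AbsRing_ball, abs, minus, plus, opp in Ht.
  simpl in Ht. rewrite Rabs_pos_eq in Ht; lra.
Qed.

Lemma pseries_zero_right_coef (c : nat -> R) (r : R) :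
  0 < r -> (forall t, 0 < t < r -> is_pseries c t 0) -> forall n, c n = 0.
Proof.
intros Hr H n. revert c H. induction n as [|n IH]; intros c H.
- now apply pseries_zero_right_coef_0 with r.
- change (c (S n)) with (PS_decr_1 c n). apply IH. intros t Ht.
  replace 0 with (scal (/ t) (plus 0 (opp (c O)))).
  + apply (is_pseries_decr_1 (V := R_NormedModule)); [|now apply H].
    unfold mult, one; simpl. field. lra.
  + rewrite (pseries_zero_right_coef_0 c r Hr H).
    unfold scal, plus, opp; simpl. unfold mult; simpl. ring.
Qed.

Lemma pow_n_RtoC (t : R) (k : nat) :
  @pow_n (AbsRing.Ring C_AbsRing) (RtoC t) k = RtoC (t ^ k).
Proof.
induction k as [|k IH]; [reflexivity|].
simpl. rewrite IH. unfold mult; simpl. now rewrite RtoC_mult.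
Qed.

Lemma is_pseries_C_Re (c : nat -> C) (t : R) (l : C) :
  is_pseries c (RtoC t) l -> is_pseries (fun n => Re (c n)) t (Re l).
Proof.
intros [H _]%is_series_C_iff. apply is_pseries_R. eapply is_series_ext; [|apply H].
intros n. cbv beta. rewrite pow_n_RtoC.
unfold scal; simpl. unfold mult, Re; simpl. ring.
Qed.

Lemma is_pseries_C_Im (c : nat -> C) (t : R) (l : C) :
  is_pseries c (RtoC t) l -> is_pseries (fun n => Im (c n)) t (Im l).
Proof.
intros [_ H]%is_series_C_iff. apply is_pseries_R. eapply is_series_ext; [|apply H].
intros n. cbv beta. rewrite pow_n_RtoC.
unfold scal; simpl. unfold mult, Im; simpl. ring.
Qed.

(** Only real arguments on the right of the centre are compared: this is what lets
    the identity theorem pass an endpoint, and the comparison pass a pole. *)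
Lemma pseries_coef_unique (c d : nat -> C) (f : R -> C) (r : R) :
  0 < r ->
  (forall t, 0 < t < r -> is_pseries c (RtoC t) (f t)) ->
  (forall t, 0 < t < r -> is_pseries d (RtoC t) (f t)) ->
  forall n, c n = d n.
Proof.
intros Hr Hc Hd n.
assert (H : forall t, 0 < t < r ->
  is_pseries (PS_minus c d) (RtoC t) (RtoC 0)).
{ intros t Ht. replace (RtoC 0) with (minus (f t) (f t))
    by apply (minus_eq_zero (G := C_AbelianGroup)).
  apply (is_pseries_minus (V := C_NormedModule)); auto. }
assert (H1 : Re (PS_minus c d n) = 0).
{ apply (pseries_zero_right_coef (fun n => Re (PS_minus c d n)) r Hr).
  intros t Ht. apply (is_pseries_C_Re _ _ _ (H t Ht)). }
assert (H2 : Im (PS_minus c d n) = 0).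
{ apply (pseries_zero_right_coef (fun n => Im (PS_minus c d n)) r Hr).
  intros t Ht. apply (is_pseries_C_Im _ _ _ (H t Ht)). }
revert H1 H2. unfold PS_minus, PS_plus, PS_opp, plus, opp, Re, Im; simpl.
destruct (c n) as [x y], (d n) as [x' y']; simpl. intros. f_equal; lra.
Qed.

Lemma is_pseries_zero_coef (c : nat -> C) (z l : C) :
  (forall n, c n = RtoC 0) -> is_pseries c z l -> l = RtoC 0.
Proof.
intros Hc H. apply (is_series_unique_C _ _ _ H).
apply is_series_ext with (a := fun _ => RtoC 0);
      [|apply (is_series_zero (V := C_NormedModule))].
intros n. rewrite Hc. symmetry. apply (@scal_zero_r C_Ring C_ModuleSpace).
Qed.

(** If the interval of vanishing that ends at [B] stopped at some point, the
    expansion at that point would vanish on its right, hence on both sides. *)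
Lemma identity_theorem_real_line (f : R -> C) (B b : R) :
  b < B ->
  (forall t, b < t < B -> f t = RtoC 0) ->
  (forall t, t < B -> exists (c : nat -> C) (r : posreal),
     forall u, Rabs u < r -> is_pseries c (RtoC u) (f (t + u))) ->
  forall t, t < B -> f t = RtoC 0.
Proof.
intros HbB Hb Han t0 Ht0.
destruct (Rlt_le_dec b t0) as [Hlt|Hle]; [apply Hb; lra|].
(* The reflected set of left endpoints, so that completeness gives their infimum. *)
set (E := fun y => - y < B /\ forall t, - y < t < B -> f t = RtoC 0).
destruct (classic (E (- t0 + 1))) as [HE|HE].
{ apply HE. lra. }
destruct (completeness E) as [m [Hm1 Hm2]].
{ exists (- t0 + 1). intros y [Hy1 Hy2].
  apply Rnot_lt_le. intros Hlt. apply HE. split; [lra|].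
  intros t Ht. apply Hy2. lra. }
{ exists (- b). split; [lra|]. intros t Ht. apply Hb. lra. }
assert (Hright : forall t, - m < t < B -> f t = RtoC 0).
{ intros t Ht.
  destruct (classic (exists y, E y /\ - y < t)) as [[y [Hy Hyt]]|Hn].
  - apply Hy. lra.
  - exfalso. assert (m <= - t); [|lra]. apply Hm2. intros y Hy.
    apply Rnot_lt_le. intros Hlt. apply Hn. exists y. split; [easy|lra]. }
assert (HmB : - m < B).
{ assert (- b <= m); [|lra]. apply Hm1. split; [lra|].
  intros t Ht. apply Hb. lra. }
destruct (Han (- m) HmB) as [c [r Hc]].
assert (Hr := cond_pos r).
set (r' := Rmin r (B + m)).
assert (Hr' : 0 < r') by (apply Rmin_glb_lt; lra).
assert (Hc0 : forall n, c n = RtoC 0).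
{ apply (pseries_coef_unique c (fun _ => RtoC 0) (fun _ => RtoC 0) r' Hr').
  - intros t Ht. pose proof (Rmin_l r (B + m)). pose proof (Rmin_r r (B + m)).
    fold r' in H, H0.
    rewrite <- (Hright (- m + t)) by lra. apply Hc. rewrite Rabs_pos_eq; lra.
  - intros t Ht.
    apply is_series_ext with (a := fun _ => RtoC 0);
      [|apply (is_series_zero (V := C_NormedModule))].
    intros n. symmetry. apply (@scal_zero_r C_Ring C_ModuleSpace). }
assert (HEr : E (m + r)).
{ split; [lra|]. intros t Ht.
  destruct (Rlt_le_dec (- m) t) as [Hgt|Hge]; [apply Hright; lra|].
  replace t with (- m + (t + m)) by ring.
  apply (is_pseries_zero_coef c (RtoC (t + m))); [exact Hc0|].
  apply Hc. rewrite Rabs_left1; lra. }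
apply Hm1 in HEr. lra.
Qed.

(** * Taylor remainders of the exponential and of binomial powers *)

Lemma pow_n_Cpow (z : C) (k : nat) : @pow_n (AbsRing.Ring C_AbsRing) z k = (z ^ k)%C.
Proof.
induction k as [|k IH]; [reflexivity|].
simpl. rewrite IH. reflexivity.
Qed.

Lemma Cmod_Cexp (z : C) : Cmod (Cexp z) = exp (Re z).
Proof.
unfold Cexp, Cmod; simpl.
pose proof (sin2_cos2 (Im z)) as H. unfold Rsqr in H.
transitivity (sqrt (Rsqr (exp (Re z)))).
- f_equal. unfold Rsqr.
  transitivity (exp (Re z) * exp (Re z) *
    (sin (Im z) * sin (Im z) + cos (Im z) * cos (Im z))); [ring|rewrite H; ring].
- apply sqrt_Rsqr, Rlt_le, exp_pos.
Qed.

Lemma Cexp_plus (z w : C) : Cexp (z + w)%C = (Cexp z * Cexp w)%C.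
Proof.
destruct z as [x y], w as [x' y']. unfold Cexp, Cplus, Cmult; simpl.
rewrite exp_plus, cos_plus, sin_plus. f_equal; ring.
Qed.

Lemma Cexp_RtoC (x : R) : Cexp (RtoC x) = RtoC (exp x).
Proof. unfold Cexp, RtoC; simpl. rewrite cos_0, sin_0. f_equal; ring. Qed.

Definition is_derive_RC (f : R -> C) (t : R) (l : C) : Prop :=
  is_derive (fun x => Re (f x)) t (Re l) /\ is_derive (fun x => Im (f x)) t (Im l).

Lemma Cmod_linear_form (v z : C) : Re v * Re z + Im v * Im z <= Cmod v * Cmod z.
Proof.
replace (Cmod v) with (Cmod (Cconj v)) by apply Cmod_conj.
rewrite <- Cmod_mult.
replace (Re v * Re z + Im v * Im z) with (Re (Cconj v * z)%C)
  by (unfold Re, Im; simpl; ring).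
eapply Rle_trans; [apply Rle_abs|apply re_le_Cmod].
Qed.

(** A mean value inequality, obtained by testing [G] against the direction of
    [G t].  The factor [rho] gained at each integration yields the geometric decay
    of the Taylor remainders of the exponential. *)
Lemma Cmod_le_of_derive_bound (u : C) (X rho B : R) (F G : R -> C) :
  0 <= B -> 0 <= rho -> Cmod u <= rho * X ->
  (forall t, is_derive_RC G t (u * F t)%C) -> G 0 = RtoC 0 ->
  (forall t, 0 <= t -> Cmod (F t) <= B * exp (t * X)) ->
  forall t, 0 <= t -> Cmod (G t) <= rho * B * exp (t * X).
Proof.
intros HB Hrho Hu HG HG0 HF t Ht.
assert (HBr : 0 <= rho * B) by now apply Rmult_le_pos.
destruct (Req_dec t 0) as [->|Ht0].
{ rewrite HG0, Cmod_0. apply Rmult_le_pos; [easy|apply Rlt_le, exp_pos]. }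
destruct (Req_dec (Cmod (G t)) 0) as [H0|H0].
{ rewrite H0. apply Rmult_le_pos; [easy|apply Rlt_le, exp_pos]. }
set (v := G t) in *.
set (h := fun x => Cmod v * (rho * B * exp (x * X))
                   - (Re v * Re (G x) + Im v * Im (G x))).
set (h' := fun x => Cmod v * (rho * B * (X * exp (x * X)))
                   - (Re v * Re (u * F x)%C + Im v * Im (u * F x)%C)).
destruct (MVT_cor2 h h' 0 t) as [c [Hc Hc']]; [lra| |].
{ intros c _. apply is_derive_Reals. unfold h, h'.
  apply (is_derive_minus (fun x => Cmod v * (rho * B * exp (x * X)))).
  - auto_derive; [easy|ring].
  - apply (is_derive_plus (fun x => Re v * Re (G x))).
    + apply is_derive_scal, HG.
    + apply is_derive_scal, HG. }
assert (Hh' : 0 <= h' c).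
{ unfold h'. apply Rge_le, Rge_minus, Rle_ge.
  eapply Rle_trans; [apply Cmod_linear_form|].
  apply Rmult_le_compat_l; [apply Cmod_ge_0|].
  rewrite Cmod_mult.
  replace (rho * B * (X * exp (c * X))) with ((rho * X) * (B * exp (c * X))) by ring.
  apply Rmult_le_compat; try apply Cmod_ge_0; [easy|]. apply HF; lra. }
assert (Hh0 : 0 <= h 0).
{ unfold h. rewrite HG0, Rmult_0_l, exp_0. simpl.
  assert (0 <= Cmod v * (rho * B)) by (apply Rmult_le_pos; [apply Cmod_ge_0|easy]).
  lra. }
assert (Hht : 0 <= h t).
{ assert (0 <= h' c * (t - 0)) by (apply Rmult_le_pos; lra). lra. }
unfold h in Hht. fold v in Hht.
replace (Re v * Re v + Im v * Im v) with (Cmod v * Cmod v) in Hht.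
2:{ pose proof (Cmod2_alt v) as H. simpl in H. rewrite !Rmult_1_r in H. exact H. }
apply Rmult_le_reg_l with (Cmod v); [pose proof (Cmod_ge_0 v); lra|lra].
Qed.

Definition exp_partial (u : C) (m : nat) : C :=
  sum_n (fun k => (u ^ k * RtoC (/ INR (fact k)))%C : C) m.

Lemma exp_partial_scal_derive (u : C) (m : nat) (t : R) :
  is_derive_RC (fun x => exp_partial (RtoC x * u) (S m)) t
               (u * exp_partial (RtoC t * u) m)%C.
Proof.
assert (Hpow : forall x k, ((RtoC x * u) ^ k)%C = (RtoC (x ^ k) * u ^ k)%C).
{ intros x k. rewrite Cpow_mult_l. now rewrite RtoC_pow. }
assert (Hterm : forall k, is_derive_RC
  (fun x => ((RtoC x * u) ^ S k * RtoC (/ INR (fact (S k))))%C) t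
  (u * ((RtoC t * u) ^ k * RtoC (/ INR (fact k))))%C).
{ intros k.
  assert (Hd : is_derive (fun x => x ^ S k / INR (fact (S k))) t (t ^ k / INR (fact k))).
  { auto_derive; [easy|].
    change (match k with O => 1 | S _ => INR k + 1 end) with (INR (S k)).
    change (fact k + k * fact k)%nat with (fact (S k)).
    rewrite fact_simpl, mult_INR. field.
    split; [apply INR_fact_neq_0|apply not_0_INR; lia]. }
  rewrite Hpow. split.
  - apply is_derive_ext with
      (f := fun x => Re (u ^ S k)%C * (x ^ S k / INR (fact (S k)))).
    { intros x. rewrite Hpow. generalize (u ^ S k)%C (x ^ S k). intros v y.
      unfold Re; simpl. unfold Rdiv. ring. }
    replace (Re (u * _)%C) with (Re (u ^ S k)%C * (t ^ k / INR (fact k)))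
      by (rewrite Cpow_S; generalize (u ^ k)%C (t ^ k); intros v y;
          unfold Re; simpl; unfold Rdiv; ring).
    now apply is_derive_scal.
  - apply is_derive_ext with
      (f := fun x => Im (u ^ S k)%C * (x ^ S k / INR (fact (S k)))).
    { intros x. rewrite Hpow. generalize (u ^ S k)%C (x ^ S k). intros v y.
      unfold Im; simpl. unfold Rdiv. ring. }
    replace (Im (u * _)%C) with (Im (u ^ S k)%C * (t ^ k / INR (fact k)))
      by (rewrite Cpow_S; generalize (u ^ k)%C (t ^ k); intros v y;
          unfold Im; simpl; unfold Rdiv; ring).
    now apply is_derive_scal. }
induction m as [|m [IH1 IH2]].
- unfold exp_partial. rewrite sum_O.
  split.
  + apply is_derive_ext with
      (f := fun x => 1 + Re ((RtoC x * u) ^ 1 * RtoC (/ INR (fact 1)))%C).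
    { intros x. rewrite sum_Sn, sum_O. unfold Re; simpl. field. }
    rewrite <- (Rplus_0_l (Re _)).
    apply (is_derive_plus (fun _ => 1)); [apply @is_derive_const|apply Hterm].
  + apply is_derive_ext with
      (f := fun x => 0 + Im ((RtoC x * u) ^ 1 * RtoC (/ INR (fact 1)))%C).
    { intros x. rewrite sum_Sn, sum_O. unfold Im; simpl. field. }
    rewrite <- (Rplus_0_l (Im _)).
    apply (is_derive_plus (fun _ => 0)); [apply @is_derive_const|apply Hterm].
- unfold exp_partial in *.
  replace (u * sum_n _ (S m))%C with
    (u * sum_n (fun k => ((RtoC t * u) ^ k * RtoC (/ INR (fact k)))%C : C) m
     + u * ((RtoC t * u) ^ S m * RtoC (/ INR (fact (S m)))))%C.
  2:{ rewrite (sum_Sn _ m). unfold plus; simpl. ring. }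
  split.
  + eapply is_derive_ext;
      [|exact (is_derive_plus _ _ _ _ _ IH1 (proj1 (Hterm (S m))))].
    intros x. rewrite (sum_Sn (G := C_AbelianMonoid)
      (fun k => ((RtoC x * u) ^ k * RtoC (/ INR (fact k)))%C) (S m)). reflexivity.
  + eapply is_derive_ext;
      [|exact (is_derive_plus _ _ _ _ _ IH2 (proj2 (Hterm (S m))))].
    intros x. rewrite (sum_Sn (G := C_AbelianMonoid)
      (fun k => ((RtoC x * u) ^ k * RtoC (/ INR (fact k)))%C) (S m)). reflexivity.
Qed.

Lemma Cexp_scal_derive (u : C) (t : R) :
  is_derive_RC (fun x => Cexp (RtoC x * u)) t (u * Cexp (RtoC t * u))%C.
Proof.
destruct u as [p q]. unfold is_derive_RC, Cexp, Re, Im; simpl.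
assert (E1 : forall x, x * p - 0 * q = x * p) by (intros; ring).
assert (E2 : forall x, x * q + 0 * p = x * q) by (intros; ring).
split.
- apply is_derive_ext with (f := fun x => exp (x * p) * cos (x * q)).
  { intros x. now rewrite E1, E2. }
  rewrite E1, E2. auto_derive; [easy|]. ring.
- apply is_derive_ext with (f := fun x => exp (x * p) * sin (x * q)).
  { intros x. now rewrite E1, E2. }
  rewrite E1, E2. auto_derive; [easy|]. ring.
Qed.

(** The remainder of order [m + 1] of [exp (t u)] has [u] times the remainder of
    order [m] as derivative in [t]. *)
Lemma exp_remainder_bound (u : C) (X rho : R) (m : nat) :
  0 <= rho <= 1 -> 0 <= X -> Cmod u <= rho * X ->
  Cmod (Cexp u - exp_partial u m) <= rho ^ S m * exp X.
Proof.
intros Hrho HX Hu.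
assert (H : forall t, 0 <= t ->
  Cmod (Cexp (RtoC t * u) - exp_partial (RtoC t * u) m) <= rho ^ S m * exp (t * X)).
{ assert (Hexp : forall t, 0 <= t -> Cmod (Cexp (RtoC t * u)) <= 1 * exp (t * X)).
  { intros t Ht. rewrite Cmod_Cexp, Rmult_1_l.
    destruct (Rle_lt_or_eq_dec (Re (RtoC t * u)) (t * X)) as [H|H].
    - replace (Re (RtoC t * u)%C) with (t * Re u) by (unfold Re; simpl; ring).
      apply Rmult_le_compat_l; [easy|].
      eapply Rle_trans; [apply Rle_abs|]. eapply Rle_trans; [apply re_le_Cmod|].
      eapply Rle_trans; [apply Hu|].
      rewrite <- (Rmult_1_l X) at 2. now apply Rmult_le_compat_r.
    - apply Rlt_le, exp_increasing, H.
    - rewrite H. apply Rle_refl. }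
  induction m as [|m IH]; intros t Ht.
  - replace (rho ^ 1) with (rho * 1) by ring.
    apply (Cmod_le_of_derive_bound u X rho 1 (fun t => Cexp (RtoC t * u))
      (fun t => Cexp (RtoC t * u) - exp_partial (RtoC t * u) 0)%C); try easy; try lra.
    + intros x. destruct (Cexp_scal_derive u x) as [H1 H2].
      unfold exp_partial.
      split.
      * eapply is_derive_ext; [|replace (Re _) with (Re (u * Cexp (x * u))%C - 0);
          [apply (is_derive_minus (fun x => Re (Cexp (RtoC x * u))) (fun _ => 1) x _ 0 H1);
           apply @is_derive_const|ring]].
        intros y. rewrite sum_O. unfold Re; simpl. unfold minus, plus, opp; simpl. field.
      * eapply is_derive_ext; [|replace (Im _) with (Im (u * Cexp (x * u))%C - 0);
          [apply (is_derive_minus (fun x => Im (Cexp (RtoC x * u))) (fun _ => 0) x _ 0 H2);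
           apply @is_derive_const|ring]].
        intros y. rewrite sum_O. unfold Im; simpl. unfold minus, plus, opp; simpl. field.
    + unfold exp_partial. rewrite sum_O, Cmult_0_l, Cexp_RtoC, exp_0. simpl.
      apply injective_projections; simpl; field.
  - replace (rho ^ S (S m)) with (rho * rho ^ S m) by (simpl; ring).
    apply (Cmod_le_of_derive_bound u X rho (rho ^ S m)
      (fun t => Cexp (RtoC t * u) - exp_partial (RtoC t * u) m)%C
      (fun t => Cexp (RtoC t * u) - exp_partial (RtoC t * u) (S m))%C); try easy.
    + now apply pow_le.
    + intros x. destruct (Cexp_scal_derive u x) as [H1 H2].
      destruct (exp_partial_scal_derive u m x) as [H3 H4].
      replace (u * (Cexp (RtoC x * u) - exp_partial (RtoC x * u) m))%C with
        (u * Cexp (RtoC x * u) - u * exp_partial (RtoC x * u) m)%C by ring.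
      split.
      * apply (is_derive_minus _ _ _ _ _ H1 H3).
      * apply (is_derive_minus _ _ _ _ _ H2 H4).
    + rewrite Cmult_0_l, Cexp_RtoC, exp_0.
      assert (Hp : forall m, exp_partial (RtoC 0) m = RtoC 1).
      { clear. induction m as [|m IH]; unfold exp_partial in *.
        - rewrite sum_O. apply injective_projections; simpl; field.
        - rewrite sum_Sn, IH. apply injective_projections; simpl; ring. }
      rewrite Hp. ring. }
specialize (H 1 Rle_0_1). now rewrite Cmult_1_l, Rmult_1_l in H.
Qed.

(** [(z + u) ^ k = sum_j u ^ j * shift_coef z k j], by Pascal's rule. *)
Fixpoint shift_coef (z : C) (k j : nat) : C :=
  match k with
  | O => match j with O => RtoC 1 | S _ => RtoC 0 end
  | S k' => (z * shift_coef z k' j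
             + match j with O => RtoC 0 | S j' => shift_coef z k' j' end)%C
  end.

Lemma shift_coef_bound (z : C) (k j : nat) :
  Cmod (shift_coef z k j) <= (Cmod z + 1) ^ k.
Proof.
revert j. induction k as [|k IH]; intros j; simpl.
- destruct j; rewrite ?Cmod_1, ?Cmod_0; lra.
- eapply Rle_trans; [apply Cmod_triangle|]. rewrite Cmod_mult.
  pose proof (Cmod_ge_0 z).
  rewrite Rmult_plus_distr_r. apply Rplus_le_compat.
  + apply Rmult_le_compat_l; [easy|apply IH].
  + rewrite Rmult_1_l. destruct j; [|apply IH].
    rewrite Cmod_0. apply pow_le. lra.
Qed.

(** The majorant is the binomial expansion of [(Cmod z + Cmod u / rho) ^ k]: each
    power of [u] beyond [m] brings at least a factor [rho ^ S m]. *)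
Lemma shift_remainder_bound (z u : C) (rho : R) (k m : nat) :
  0 < rho <= 1 ->
  Cmod ((z + u) ^ k - sum_n (fun j => (u ^ j * shift_coef z k j)%C : C) m)
  <= rho ^ S m * (Cmod z + Cmod u / rho) ^ k.
Proof.
intros Hrho. pose proof (Cmod_ge_0 z) as Hz. pose proof (Cmod_ge_0 u) as Hu.
assert (Hur : 0 <= Cmod u / rho) by (apply Rdiv_le_0_compat; lra).
set (Q := Cmod z + Cmod u / rho). assert (HQ : 0 <= Q) by (unfold Q; lra).
assert (Hzu : forall k, Cmod ((z + u) ^ k) <= Q ^ k).
{ intros i. rewrite Cmod_pow. apply pow_incr. split; [apply Cmod_ge_0|].
  eapply Rle_trans; [apply Cmod_triangle|]. apply Rplus_le_compat_l.
  rewrite <- (Rmult_1_r (Cmod u)) at 1. apply Rmult_le_compat_l; [easy|].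
  rewrite <- Rinv_1. apply Rinv_le_contravar; lra. }
revert m. induction k as [|k IH]; intros m.
- replace (sum_n _ m : C) with (RtoC 1).
  + replace ((z + u) ^ 0 - RtoC 1)%C with (RtoC 0) by (simpl; ring).
    rewrite Cmod_0. apply Rmult_le_pos; apply pow_le; lra.
  + clear. induction m as [|m IH].
    * rewrite sum_O. simpl. ring.
    * rewrite sum_Sn, <- IH. simpl. unfold plus; simpl. ring.
- (* The remainders satisfy Pascal's rule too. *)
  assert (Hrec : forall m,
    sum_n (fun j => (u ^ j * shift_coef z (S k) j)%C : C) (S m) =
    (z * sum_n (fun j => (u ^ j * shift_coef z k j)%C : C) (S m)
     + u * sum_n (fun j => (u ^ j * shift_coef z k j)%C : C) m)%C).
  { clear. induction m as [|m IH].
    - rewrite !sum_Sn, !sum_O. unfold plus; simpl. ring.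
    - rewrite sum_Sn, IH.
      rewrite (sum_Sn (fun j => (u ^ j * shift_coef z k j)%C) (S m)).
      rewrite (sum_Sn (fun j => (u ^ j * shift_coef z k j)%C) m).
      unfold plus; simpl. ring. }
  destruct m as [|m].
  + rewrite sum_O.
    replace ((z + u) ^ S k - u ^ 0 * shift_coef z (S k) 0)%C with
      (z * ((z + u) ^ k - sum_n (fun j => (u ^ j * shift_coef z k j)%C : C) 0)
       + u * (z + u) ^ k)%C by (rewrite sum_O; simpl; ring).
    eapply Rle_trans; [apply Cmod_triangle|]. rewrite !Cmod_mult.
    replace (rho ^ 1 * Q ^ S k) with
      (Cmod z * (rho ^ 1 * Q ^ k) + Cmod u * Q ^ k)
      by (change (Q ^ S k) with ((Cmod z + Cmod u / rho) * Q ^ k); simpl; field; lra).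
    apply Rplus_le_compat; apply Rmult_le_compat_l; auto.
  + rewrite Hrec.
    replace ((z + u) ^ S k - _)%C with
      (z * ((z + u) ^ k - sum_n (fun j => (u ^ j * shift_coef z k j)%C : C) (S m))
       + u * ((z + u) ^ k - sum_n (fun j => (u ^ j * shift_coef z k j)%C : C) m))%C
      by (simpl; ring).
    eapply Rle_trans; [apply Cmod_triangle|]. rewrite !Cmod_mult.
    replace (rho ^ S (S m) * Q ^ S k) with
      (Cmod z * (rho ^ S (S m) * Q ^ k) + Cmod u * (rho ^ S m * Q ^ k))
      by (change (Q ^ S k) with ((Cmod z + Cmod u / rho) * Q ^ k); simpl; field; lra).
    apply Rplus_le_compat; apply Rmult_le_compat_l; auto.
Qed.

Definition entire_coefs (c : nat -> C) : Prop :=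
  forall r, 0 <= r -> ex_series (fun k => Cmod (c k) * r ^ k).

Definition entire_sum (c : nat -> C) (z : C) : C :=
  CSeries (fun k => (z ^ k * c k)%C).

Lemma ex_series_C_le (u : nat -> C) (g : nat -> R) :
  (forall n, Cmod (u n) <= g n) -> ex_series g -> is_series u (CSeries u).
Proof.
intros Hle Hg.
destruct (ex_series_le (K := C_AbsRing) (V := C_CompleteNormedModule) u g Hle Hg)
  as [l Hl].
rewrite (is_series_CSeries u l); exact Hl.
Qed.

Lemma entire_sum_spec (c : nat -> C) (z : C) :
  entire_coefs c -> is_series (fun k => (z ^ k * c k)%C) (entire_sum c z).
Proof.
intros Hc. apply ex_series_C_le with (fun k => Cmod (c k) * Cmod z ^ k).
- intros n. rewrite Cmod_mult, Cmod_pow. lra.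
- apply Hc, Cmod_ge_0.
Qed.

Lemma is_pseries_C_iff (c : nat -> C) (z l : C) :
  is_pseries c z l <-> is_series (fun k => (z ^ k * c k)%C) l.
Proof.
assert (E : forall k, Cmult (@pow_n (AbsRing.Ring C_AbsRing) z k) (c k)
                      = (z ^ k * c k)%C)
  by (intros k; exact (f_equal (fun w => Cmult w (c k)) (pow_n_Cpow z k))).
unfold is_pseries. split; apply is_series_ext; intros n; [|symmetry]; apply E.
Qed.

(** Re-expansion about [z].  The ratio 1/2 asks for summability on a disc larger than
    the one that contains [z + u], which costs nothing for an entire function. *)
Lemma entire_sum_shift (c : nat -> C) (z : C) :
  entire_coefs c ->
  exists e, forall u, is_pseries e u (entire_sum c (z + u)%C).
Proof.
intros Hc.
exists (fun j => CSeries (fun k => (c k * shift_coef z k j)%C)). intros u.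
pose proof (Cmod_ge_0 z) as Hz. pose proof (Cmod_ge_0 u) as Hu.
apply (is_pseries_sum_of_remainders (V := C_NormedModule)
  (fun k => ((z + u) ^ k * c k)%C) _ (fun k j => (c k * shift_coef z k j)%C)
  _ u (fun k => Cmod (c k) * (Cmod z + Cmod u / (1 / 2)) ^ k) (1 / 2)).
- now apply entire_sum_spec.
- apply Hc. lra.
- lra.
- intros j. apply ex_series_C_le with (fun k => Cmod (c k) * (Cmod z + 1) ^ k).
  + intros k. rewrite Cmod_mult. apply Rmult_le_compat_l; [apply Cmod_ge_0|].
    apply shift_coef_bound.
  + apply Hc. lra.
- intros k m.
  match goal with |- norm ?x <= _ => replace x with
    (c k * ((z + u) ^ k - sum_n (fun j => (u ^ j * shift_coef z k j)%C : C) m))%C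
  end.
  + change (norm ?x) with (Cmod x). rewrite Cmod_mult, Rmult_assoc.
    apply Rmult_le_compat_l; [apply Cmod_ge_0|].
    eapply Rle_trans; [apply shift_remainder_bound with (rho := 1 / 2); lra|].
    rewrite Rmult_comm. apply Rmult_le_compat_l; [apply pow_le; lra|].
    simpl. assert (0 <= (1 / 2) ^ m) by (apply pow_le; lra). lra.
  + transitivity ((z + u) ^ k * c k
      - c k * sum_n (fun j => (u ^ j * shift_coef z k j)%C : C) m)%C; [ring|].
    apply (f_equal (fun w => ((z + u) ^ k * c k - w)%C)).
    etransitivity; [symmetry; exact (sum_n_scal_l (K := C_Ring) (V := C_ModuleSpace)
      (c k) (fun j => (u ^ j * shift_coef z k j)%C) m)|].
    apply sum_n_ext. intros j.
    transitivity (u ^ j * (c k * shift_coef z k j))%C.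
    * change (c k * (u ^ j * shift_coef z k j) = u ^ j * (c k * shift_coef z k j))%C.
      ring.
    * exact (f_equal (fun w => Cmult w (c k * shift_coef z k j)%C)
        (eq_sym (pow_n_Cpow u j))).
Qed.

(** * Power functions and their sums *)

Lemma Rpower_pos (x y : R) : 0 < Rpower x y.
Proof. apply exp_pos. Qed.

Lemma Rpower_opp_le (x y c : R) : 0 <= c -> 0 < x <= y -> Rpower y (- c) <= Rpower x (- c).
Proof.
intros Hc H. rewrite !Rpower_Ropp. apply Rinv_le_contravar.
- apply Rpower_pos.
- now apply Rle_Rpower_l.
Qed.

Lemma Rpower_pred (x c : R) : 0 < x -> Rpower x (c - 1) = Rpower x c / x.
Proof.
intros Hx. unfold Rminus. rewrite Rpower_plus, Rpower_Ropp, Rpower_1 by easy.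
reflexivity.
Qed.

Lemma is_derive_Rpower_shift (x c t : R) :
  0 < x + t -> is_derive (fun u => Rpower (x + u) c) t (c * Rpower (x + t) (c - 1)).
Proof.
intros H. rewrite Rpower_pred by easy. unfold Rpower.
auto_derive; [easy|]. field. lra.
Qed.

Lemma is_lim_seq_Rpower_0 (a c : R) :
  0 < a -> 0 < c -> is_lim_seq (fun n => Rpower (INR n + a) (- c)) 0.
Proof.
intros Ha Hc. unfold Rpower.
assert (Hln : is_lim_seq (fun n => ln (INR n + a)) p_infty).
{ apply (is_lim_comp_seq ln _ p_infty); [apply is_lim_ln_p|now exists O|].
  replace p_infty with (Rbar_plus p_infty a) by easy.
  eapply is_lim_seq_plus; [apply is_lim_seq_INR|apply is_lim_seq_const|easy]. }
apply (is_lim_comp_seq exp _ m_infty); [apply is_lim_exp_m|now exists O|].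
replace m_infty with (Rbar_mult (- c) p_infty).
- now apply is_lim_seq_scal_l.
- simpl. destruct (Rle_dec 0 (- c)); [exfalso; lra|easy].
Qed.

(** Comparison with the telescoping series of [y ^ (1 - sigma) / (sigma - 1)]. *)
Lemma ex_series_Rpower (a sigma : R) :
  0 < a -> 1 < sigma -> ex_series (fun n => Rpower (INR n + a) (- sigma)).
Proof.
intros Ha Hs.
apply ex_series_incr_1.
set (g := fun n => Rpower (INR n + a) (- (sigma - 1)) / (sigma - 1)).
apply (ex_series_le (K := R_AbsRing) (V := R_CompleteNormedModule) _
  (fun n => g n - g (S n))).
- intros n. change (norm ?x) with (Rabs x). rewrite Rabs_pos_eq by apply Rlt_le, Rpower_pos.
  pose proof (pos_INR n) as Hn.
  destruct (MVT_cor2 (fun t => Rpower (INR n + a + t) (- (sigma - 1)))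
    (fun t => - (sigma - 1) * Rpower (INR n + a + t) (- (sigma - 1) - 1)) 0 1)
    as [c [Hc Hc']]; [lra| |].
  { intros c Hc. apply is_derive_Reals, is_derive_Rpower_shift. lra. }
  rewrite Rplus_0_r in Hc. unfold g.
  rewrite S_INR. replace (INR n + 1 + a) with (INR n + a + 1) by ring.
  replace (Rpower (INR n + a) (- (sigma - 1)) / (sigma - 1)
           - Rpower (INR n + a + 1) (- (sigma - 1)) / (sigma - 1))
    with (Rpower (INR n + a + c) (- sigma)).
  + apply Rpower_opp_le; lra.
  + replace (- (sigma - 1) - 1) with (- sigma) in Hc by ring.
    apply Rmult_eq_reg_r with (sigma - 1); [|lra].
    transitivity (- (Rpower (INR n + a + 1) (- (sigma - 1))
                     - Rpower (INR n + a) (- (sigma - 1)))).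
    * rewrite Hc. ring.
    * field. lra.
- exists (g O - 0). unfold is_series.
  apply filterlim_ext with (f := fun n => g O - g (S n)).
  + intros n. induction n as [|n IH]; [now rewrite sum_O|].
    rewrite sum_Sn, <- IH. unfold plus; simpl. ring.
  + apply (is_lim_seq_minus' (fun _ => g O)); [apply is_lim_seq_const|].
    apply is_lim_seq_incr_1 with (u := g). unfold g.
    replace 0 with (0 / (sigma - 1)) by (field; lra).
    apply (is_lim_seq_scal_r _ (/ (sigma - 1)) 0).
    apply is_lim_seq_Rpower_0; lra.
Qed.

(** * Euler-Maclaurin summation of powers *)

Fixpoint rpoch (w : R) (k : nat) : R :=
  match k with O => 1 | S j => rpoch w j * (w + INR j) end.

(** Up to the sign [(-1) ^ k], the [k]-th derivative of [y ^ (- w)]. *)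
Definition power_diff (w : R) (k : nat) (y : R) : R :=
  rpoch w k * Rpower y (- w - INR k).

(** With [w = s - 1], this is [s - 1] times the finite part of the Euler-Maclaurin
    formula for [zeta(s, y)].  The sign is felt at [k = 1] only, the other odd
    coefficients being 0; with it, all orders are treated alike. *)
Definition em_sum (m : nat) (w y : R) : R :=
  sum_f_R0 (fun k => (-1) ^ k * bern_coef k * power_diff w k y) m.

Definition em_int (m : nat) (w x : R) : R :=
  RInt (fun t => bern_poly m t * Rpower (x + t) (- (w + INR m + 1))) 0 1.

Lemma is_derive_power_diff (w : R) (k : nat) (x t : R) :
  0 < x + t ->
  is_derive (fun u => power_diff w k (x + u)) t (- power_diff w (S k) (x + t)).
Proof.
intros H. unfold power_diff.
replace (- (rpoch w (S k) * Rpower (x + t) (- w - INR (S k)))) with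
  (rpoch w k * ((- w - INR k) * Rpower (x + t) (- w - INR k - 1))).
- now apply is_derive_scal, is_derive_Rpower_shift.
- rewrite S_INR. replace (- w - (INR k + 1)) with (- w - INR k - 1) by ring.
  simpl. ring.
Qed.

Lemma continuous_power_diff (w : R) (k : nat) (x t : R) :
  0 < x + t -> continuous (fun u => power_diff w k (x + u)) t.
Proof.
intros H. apply (ex_derive_continuous (V := R_NormedModule)).
exists (- power_diff w (S k) (x + t)). now apply is_derive_power_diff.
Qed.

Lemma continuous_bern_poly (k : nat) (t : R) : continuous (bern_poly k) t.
Proof.
apply (ex_derive_continuous (V := R_NormedModule)). destruct k.
- exists 0. apply is_derive_bern_poly_0.
- exists (bern_poly k t). apply is_derive_bern_poly_succ.
Qed.

(** Repeated integration by parts, in the form of an explicit antiderivative. *)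
Lemma is_derive_bern_power_sum (m : nat) (w x t : R) :
  0 < x + t ->
  is_derive (fun u => sum_f_R0 (fun k => bern_poly k u * power_diff w k (x + u)) m) t
            (- (bern_poly m t * power_diff w (S m) (x + t))).
Proof.
intros H. induction m as [|m IH].
- simpl. replace (- _) with
    (0 * power_diff w 0 (x + t) + bern_poly 0 t * - power_diff w 1 (x + t)) by ring.
  apply (is_derive_mult (bern_poly 0) (fun u => power_diff w 0 (x + u))).
  + apply is_derive_bern_poly_0.
  + now apply is_derive_power_diff.
  + intros; apply Rmult_comm.
- replace (- _) with (- (bern_poly m t * power_diff w (S m) (x + t))
    + (bern_poly m t * power_diff w (S m) (x + t)
       + bern_poly (S m) t * - power_diff w (S (S m)) (x + t))) by ring.
  apply (is_derive_plus (fun u => sum_f_R0 (fun k => bern_poly k u * power_diff w k (x + u)) m)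
    (fun u => bern_poly (S m) u * power_diff w (S m) (x + u))); [exact IH|].
  apply (is_derive_mult (bern_poly (S m)) (fun u => power_diff w (S m) (x + u))).
  + apply is_derive_bern_poly_succ.
  + now apply is_derive_power_diff.
  + intros; apply Rmult_comm.
Qed.

Lemma bern_coef_sign (k : nat) : (-1) ^ S (S k) * bern_coef (S (S k)) = bern_coef (S (S k)).
Proof. rewrite <- bern_poly_1. apply bern_poly_1_of_ge_2. Qed.

Lemma em_sum_bern_coef (m : nat) (w y : R) :
  sum_f_R0 (fun k => bern_coef k * power_diff w k y) (S m)
  = em_sum (S m) w y - power_diff w 1 y.
Proof.
induction m as [|m IH].
- unfold em_sum. simpl sum_f_R0. rewrite bern_coef_0, bern_coef_1. simpl pow. field.
- unfold em_sum in *. rewrite tech5, IH.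
  rewrite (tech5 (fun k => (-1) ^ k * bern_coef k * power_diff w k y) (S m)).
  rewrite bern_coef_sign. ring.
Qed.

(** The constant of integration [c] is left free: [c = 0] serves for the
    continuation, and the value at which the kernel vanishes at both ends serves for
    the sign. *)
Lemma is_RInt_em (m : nat) (c w x : R) :
  0 < x ->
  is_RInt (fun t => (c - bern_poly (S m) t) * power_diff w (S (S m)) (x + t)) 0 1
    (power_diff w 1 x - em_sum (S m) w x + em_sum (S m) w (x + 1)
     - c * (power_diff w (S m) (x + 1) - power_diff w (S m) x)).
Proof.
intros Hx.
set (f := fun u => sum_f_R0 (fun k => bern_poly k u * power_diff w k (x + u)) (S m)
                   - c * power_diff w (S m) (x + u)).
replace (power_diff w 1 x - em_sum (S m) w x + em_sum (S m) w (x + 1)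
     - c * (power_diff w (S m) (x + 1) - power_diff w (S m) x))
  with (minus (f 1) (f 0)).
- apply (is_RInt_derive f).
  + rewrite Rmin_left, Rmax_right by lra. intros t Ht. unfold f.
    replace ((c - bern_poly (S m) t) * power_diff w (S (S m)) (x + t)) with
      (- (bern_poly (S m) t * power_diff w (S (S m)) (x + t))
       - c * - power_diff w (S (S m)) (x + t)) by ring.
    apply (is_derive_minus (fun u =>
      sum_f_R0 (fun k => bern_poly k u * power_diff w k (x + u)) (S m))).
    * apply is_derive_bern_power_sum. lra.
    * apply is_derive_scal, is_derive_power_diff. lra.
  + rewrite Rmin_left, Rmax_right by lra. intros t Ht.
    apply (continuous_mult (fun t => c - bern_poly (S m) t)).
    * apply (continuous_minus (fun _ => c)).
      -- apply continuous_const.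
      -- apply continuous_bern_poly.
    * apply continuous_power_diff. lra.
- change (minus (f 1) (f 0)) with (f 1 - f 0). unfold f. rewrite Rplus_0_r.
  rewrite (sum_eq _ (fun k => (-1) ^ k * bern_coef k * power_diff w k (x + 1)) (S m))
    by (intros; now rewrite bern_poly_1).
  rewrite (sum_eq (fun k => bern_poly k 0 * power_diff w k x)
    (fun k => bern_coef k * power_diff w k x) (S m))
    by (intros; now rewrite bern_poly_0).
  rewrite em_sum_bern_coef. apply Rminus_diag_uniq. unfold em_sum. ring.
Qed.

Lemma continuous_bern_power (m : nat) (sigma x t : R) :
  0 < x + t -> continuous (fun u => bern_poly m u * Rpower (x + u) sigma) t.
Proof.
intros H. apply (continuous_mult (bern_poly m) (fun u => Rpower (x + u) sigma)).
- apply continuous_bern_poly.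
- apply (ex_derive_continuous (V := R_NormedModule)).
  eexists. now apply is_derive_Rpower_shift.
Qed.

Lemma is_RInt_em_int (m : nat) (w x : R) :
  0 < x ->
  is_RInt (fun t => bern_poly m t * Rpower (x + t) (- (w + INR m + 1))) 0 1 (em_int m w x).
Proof.
intros Hx. unfold em_int.
apply (RInt_correct (V := R_CompleteNormedModule)), ex_RInt_continuous.
rewrite Rmin_left, Rmax_right by lra. intros t Ht.
apply continuous_bern_power. lra.
Qed.

Lemma em_step (m : nat) (w x : R) :
  0 < x ->
  power_diff w 1 x = em_sum (S m) w x - em_sum (S m) w (x + 1)
                     - rpoch w (S (S m)) * em_int (S m) w x.
Proof.
intros Hx. pose proof (is_RInt_em m 0 w x Hx) as H1.
pose proof (is_RInt_scal _ _ _ (- rpoch w (S (S m))) _ (is_RInt_em_int (S m) w x Hx)) as H2.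
apply (is_RInt_unique (V := R_CompleteNormedModule)) in H1.
apply (is_RInt_unique (V := R_CompleteNormedModule)) in H2.
rewrite (RInt_ext _ (fun t => (0 - bern_poly (S m) t) * power_diff w (S (S m)) (x + t))) in H2.
- rewrite H1 in H2. unfold scal in H2; simpl in H2. unfold mult in H2; simpl in H2.
  simpl. lra.
- intros t _. unfold scal; simpl; unfold mult; simpl. unfold power_diff.
  replace (- (w + match m with O => 1 | S _ => INR m + 1 end + 1)) with (- w - INR (S (S m))).
  + simpl. ring.
  + rewrite !S_INR. change (match m with O => 1 | S _ => INR m + 1 end) with (INR (S m)).
    rewrite S_INR. ring.
Qed.

(** * Expansion of powers in the exponent *)

(** The Taylor coefficients of [Y ^ (- sigma - z)] in [z]. *)
Definition log_weight (sigma : R) (k : nat) (Y : R) : R :=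
  Rpower Y (- sigma) * ((- ln Y) ^ k * / INR (fact k)).

(** Majorant of [Y ^ (- sigma - z)] for [Cmod z <= r], valid on both sides of
    [Y = 1]; it stays decreasing and summable as long as [r] is small. *)
Definition two_powers (sigma r x : R) : R :=
  Rpower x (- (sigma - r)) + Rpower x (- (sigma + r)).

Lemma two_powers_pos (sigma r x : R) : 0 < two_powers sigma r x.
Proof. apply Rplus_lt_0_compat; apply Rpower_pos. Qed.

Lemma two_powers_le (sigma r x Y : R) :
  0 <= r <= sigma -> 0 < x <= Y -> two_powers sigma r Y <= two_powers sigma r x.
Proof. intros H1 H2. apply Rplus_le_compat; apply Rpower_opp_le; lra. Qed.

Lemma ex_series_two_powers (a sigma r : R) :
  0 < a -> 0 <= r -> 1 < sigma - r ->
  ex_series (fun n => two_powers sigma r (INR n + a)).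
Proof.
intros Ha Hr Hs. apply (ex_series_plus (V := R_NormedModule));
apply ex_series_Rpower; lra.
Qed.

Lemma Rpower_exp_abs_ln_le (sigma r Y : R) :
  Rpower Y (- sigma) * exp (r * Rabs (ln Y)) <= two_powers sigma r Y.
Proof.
unfold two_powers, Rpower. rewrite <- exp_plus.
destruct (Rle_dec 0 (ln Y)) as [H|H].
- rewrite Rabs_pos_eq by easy.
  replace (- sigma * ln Y + r * ln Y) with (- (sigma - r) * ln Y) by ring.
  pose proof (exp_pos (- (sigma + r) * ln Y)). lra.
- rewrite Rabs_left1 by lra.
  replace (- sigma * ln Y + r * - ln Y) with (- (sigma + r) * ln Y) by ring.
  pose proof (exp_pos (- (sigma - r) * ln Y)). lra.
Qed.

Lemma power_term_le_exp (x : R) (k : nat) : 0 <= x -> x ^ k * / INR (fact k) <= exp x.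
Proof.
intros Hx. pose proof (is_exp_Reals x) as H. apply is_pseries_R in H.
assert (Hpos : forall n, 0 <= / INR (fact n) * x ^ n).
{ intros n. apply Rmult_le_pos; [|now apply pow_le].
  apply Rlt_le, Rinv_0_lt_compat, INR_fact_lt_0. }
apply Rle_trans with (sum_n (fun n => / INR (fact n) * x ^ n) k).
- rewrite Rmult_comm, sum_n_Reals. destruct k as [|k]; [apply Rle_refl|].
  rewrite tech5. pose proof (cond_pos_sum _ k Hpos). lra.
- apply (is_lim_seq_incr_compare (sum_n (fun n => / INR (fact n) * x ^ n))); [exact H|].
  intros n. rewrite sum_Sn. pose proof (Hpos (S n)). unfold plus; simpl in *. lra.
Qed.

(** Logarithms are absorbed by an arbitrarily small power. *)
Lemma log_weight_bound (sigma r : R) (k : nat) (Y : R) :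
  0 < r -> Rabs (log_weight sigma k Y) <= (/ r) ^ k * two_powers sigma r Y.
Proof.
intros Hr. unfold log_weight.
rewrite Rabs_mult, (Rabs_pos_eq (Rpower _ _)) by apply Rlt_le, Rpower_pos.
pose proof (power_term_le_exp (r * Rabs (ln Y)) k) as H.
assert (H0 : 0 <= r * Rabs (ln Y)) by (apply Rmult_le_pos; [lra|apply Rabs_pos]).
specialize (H H0).
rewrite Rabs_mult, <- RPow_abs, Rabs_Ropp.
rewrite (Rabs_pos_eq (/ _)) by apply Rlt_le, Rinv_0_lt_compat, INR_fact_lt_0.
replace (Rabs (ln Y) ^ k) with ((/ r) ^ k * (r * Rabs (ln Y)) ^ k).
2:{ rewrite <- Rpow_mult_distr. f_equal. field. lra. }
rewrite (Rmult_assoc ((/ r) ^ k)), <- Rmult_assoc, (Rmult_comm (Rpower _ _)), Rmult_assoc.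
apply Rmult_le_compat_l.
- apply pow_le. apply Rlt_le, Rinv_0_lt_compat, Hr.
- eapply Rle_trans; [|apply Rpower_exp_abs_ln_le].
  apply Rmult_le_compat_l; [apply Rlt_le, Rpower_pos|exact H].
Qed.

Lemma Cpower_remainder_bound (sigma r rho Y : R) (z : C) (m : nat) :
  0 <= rho <= 1 -> 0 <= r -> Cmod z <= rho * r ->
  Cmod (RtoC (Rpower Y (- sigma)) * Cexp (z * RtoC (- ln Y))
        - sum_n (fun k => (z ^ k * RtoC (log_weight sigma k Y))%C : C) m)
  <= rho ^ S m * two_powers sigma r Y.
Proof.
intros Hrho Hr Hz.
replace (sum_n _ m : C) with
  (RtoC (Rpower Y (- sigma)) * exp_partial (z * RtoC (- ln Y)) m)%C.
- replace (RtoC (Rpower Y (- sigma)) * Cexp (z * RtoC (- ln Y))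
    - RtoC (Rpower Y (- sigma)) * exp_partial (z * RtoC (- ln Y)) m)%C with
    (RtoC (Rpower Y (- sigma)) * (Cexp (z * RtoC (- ln Y)) -
       exp_partial (z * RtoC (- ln Y)) m))%C by ring.
  rewrite Cmod_mult, Cmod_R, Rabs_pos_eq by apply Rlt_le, Rpower_pos.
  apply Rle_trans with
    (Rpower Y (- sigma) * (rho ^ S m * exp (r * Rabs (ln Y)))).
  + apply Rmult_le_compat_l; [apply Rlt_le, Rpower_pos|].
    apply exp_remainder_bound; [easy| |].
    * apply Rmult_le_pos; [easy|apply Rabs_pos].
    * rewrite Cmod_mult, Cmod_R, Rabs_Ropp, <- Rmult_assoc.
      apply Rmult_le_compat_r; [apply Rabs_pos|easy].
  + rewrite <- Rmult_assoc, (Rmult_comm (Rpower _ _)), Rmult_assoc.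
    apply Rmult_le_compat_l; [now apply pow_le|apply Rpower_exp_abs_ln_le].
- unfold exp_partial.
  etransitivity; [symmetry; exact (sum_n_scal_l (K := C_Ring) (V := C_ModuleSpace)
      (RtoC (Rpower Y (- sigma)))
      (fun k => ((z * RtoC (- ln Y)) ^ k * RtoC (/ INR (fact k)))%C) m)|].
  apply sum_n_ext. intros k.
  change (RtoC (Rpower Y (- sigma)) * ((z * RtoC (- ln Y)) ^ k * RtoC (/ INR (fact k)))
          = z ^ k * RtoC (log_weight sigma k Y))%C.
  rewrite Cpow_mult_l, <- RtoC_pow. unfold log_weight. rewrite !RtoC_mult. ring.
Qed.

Lemma sum_n_RtoC (u : nat -> R) (m : nat) :
  RtoC (sum_n u m) = sum_n (fun k => RtoC (u k)) m.
Proof.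
induction m as [|m IH]; [now rewrite !sum_O|].
rewrite !sum_Sn, <- IH. apply RtoC_plus.
Qed.

Lemma Rpower_remainder_bound (sigma r rho Y w : R) (m : nat) :
  0 <= rho <= 1 -> 0 <= r -> Rabs w <= rho * r ->
  Rabs (Rpower Y (- (w + sigma)) - sum_n (fun k => w ^ k * log_weight sigma k Y) m)
  <= rho ^ S m * two_powers sigma r Y.
Proof.
intros Hrho Hr Hw.
rewrite <- Cmod_R in Hw |- *.
eapply Rle_trans; [|apply (Cpower_remainder_bound sigma r rho Y (RtoC w) m); easy].
apply Req_le. f_equal. rewrite RtoC_minus. f_equal.
- rewrite <- RtoC_mult, Cexp_RtoC, <- RtoC_mult. f_equal.
  unfold Rpower. rewrite <- exp_plus. f_equal. ring.
- f_equal. rewrite sum_n_RtoC. apply sum_n_ext. intros k.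
  now rewrite RtoC_mult, RtoC_pow.
Qed.

(** * The continuation to the left, on the real line *)

Lemma bern_int_bound (m : nat) :
  exists B, 0 <= B /\ forall (g : R -> R) (M l : R), 0 <= M ->
    (forall t, 0 <= t <= 1 -> Rabs (g t) <= M) ->
    is_RInt (fun t => bern_poly m t * g t) 0 1 l -> Rabs l <= B * M.
Proof.
destruct (bounded_continuity (V := R_NormedModule) (bern_poly m) 0 1) as [B HB].
{ intros t _. apply continuous_bern_poly. }
exists B. split.
- eapply Rle_trans; [|apply Rlt_le, (HB 0); lra]. apply norm_ge_0.
- intros g M l HM Hg Hl.
  replace (B * M) with ((1 - 0) * (B * M)) by ring.
  apply (norm_RInt_le_const (V := R_NormedModule)
    (fun t => bern_poly m t * g t) 0 1); [lra| |exact Hl].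
  intros t Ht. change (norm ?x) with (Rabs x). rewrite Rabs_mult.
  apply Rmult_le_compat; try apply Rabs_pos; [|now apply Hg].
  apply Rlt_le, (HB t Ht).
Qed.

Lemma ex_series_em_int (a : R) (m : nat) (w : R) :
  0 < a -> 0 < w + INR m -> ex_series (fun n => em_int m w (INR n + a)).
Proof.
intros Ha Hw. destruct (bern_int_bound m) as [B [HB Hint]].
apply (ex_series_le (K := R_AbsRing) (V := R_CompleteNormedModule) _
  (fun n => B * Rpower (INR n + a) (- (w + INR m + 1)))).
- intros n. pose proof (pos_INR n).
  apply (Hint (fun t => Rpower (INR n + a + t) (- (w + INR m + 1)))).
  + apply Rlt_le, Rpower_pos.
  + intros t Ht. rewrite Rabs_pos_eq by apply Rlt_le, Rpower_pos.
    apply Rpower_opp_le; lra.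
  + apply is_RInt_em_int. lra.
- apply (ex_series_scal (V := R_NormedModule)), ex_series_Rpower; lra.
Qed.

(** The value at [w = s - 1] of [(s - 1) zeta(s, a)], computed with an
    Euler-Maclaurin formula of order [S m]; meaningful for [- S m < w]. *)
Definition em_value (a : R) (m : nat) (w : R) : R :=
  em_sum (S m) w a
  - rpoch w (S (S m)) * Series (fun n => em_int (S m) w (INR n + a)).

Lemma em_partial_sum (a : R) (m : nat) (w : R) (n : nat) :
  0 < a ->
  sum_n (fun k => power_diff w 1 (INR k + a)) n + em_sum (S m) w (INR (S n) + a) =
  em_sum (S m) w a - rpoch w (S (S m)) * sum_n (fun k => em_int (S m) w (INR k + a)) n.
Proof.
intros Ha. induction n as [|n IH].
- rewrite !sum_O, (em_step m) by (simpl; lra).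
  simpl (INR 0). simpl (INR 1). rewrite Rplus_0_l. rewrite (Rplus_comm 1 a). ring.
- rewrite !sum_Sn. change (@plus R_AbelianMonoid) with Rplus.
  rewrite (em_step m w (INR (S n) + a)) by (pose proof (pos_INR (S n)); lra).
  rewrite (S_INR (S n)). replace (INR (S n) + 1 + a) with (INR (S n) + a + 1) by ring.
  lra.
Qed.

Lemma em_value_lim (a : R) (m : nat) (w : R) :
  0 < a -> 0 < w + INR (S m) ->
  is_lim_seq (fun n => sum_n (fun k => power_diff w 1 (INR k + a)) n
                       + em_sum (S m) w (INR (S n) + a)) (em_value a m w).
Proof.
intros Ha Hw.
apply is_lim_seq_ext with (u := fun n => em_sum (S m) w a
  - rpoch w (S (S m)) * sum_n (fun k => em_int (S m) w (INR k + a)) n).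
{ intros n. symmetry. now apply em_partial_sum. }
apply is_lim_seq_minus'; [apply is_lim_seq_const|].
apply (is_lim_seq_scal_l _ (rpoch w (S (S m)))
  (Series (fun n => em_int (S m) w (INR n + a)))).
apply Series_correct. now apply ex_series_em_int.
Qed.

Lemma power_diff_lim (a w : R) (k : nat) :
  0 < a -> 0 < w + INR k ->
  is_lim_seq (fun n => power_diff w k (INR (S n) + a)) 0.
Proof.
intros Ha Hw.
apply (is_lim_seq_incr_1 (fun n => power_diff w k (INR n + a))).
unfold power_diff. replace (- w - INR k) with (- (w + INR k)) by ring.
replace 0 with (rpoch w k * 0) by ring.
apply (is_lim_seq_scal_l _ (rpoch w k) 0). now apply is_lim_seq_Rpower_0.
Qed.

(** Under the limit of [em_value_lim], consecutive orders differ by one power of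
    [n + a] that tends to 0. *)
Lemma em_value_succ (a : R) (m : nat) (w : R) :
  0 < a -> 0 < w + INR (S m) -> em_value a (S m) w = em_value a m w.
Proof.
intros Ha Hw.
assert (Hw' : 0 < w + INR (S (S m))) by (rewrite (S_INR (S m)); lra).
pose proof (em_value_lim a m w Ha Hw) as H1.
pose proof (em_value_lim a (S m) w Ha Hw') as H2.
assert (H3 : is_lim_seq (fun n => (-1) ^ S (S m) * bern_coef (S (S m))
    * power_diff w (S (S m)) (INR (S n) + a)) 0).
{ replace 0 with ((-1) ^ S (S m) * bern_coef (S (S m)) * 0) by ring.
  apply (is_lim_seq_scal_l _ _ 0). now apply power_diff_lim. }
pose proof (is_lim_seq_plus' _ _ _ _ H1 H3) as H4.
apply is_lim_seq_unique in H2. apply is_lim_seq_unique in H4.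
rewrite Rplus_0_r in H4.
enough (E : Finite (em_value a (S m) w) = Finite (em_value a m w)) by now injection E.
rewrite <- H2, <- H4. apply Lim_seq_ext. intros n.
unfold em_sum. rewrite (tech5 _ (S m)). ring.
Qed.

Lemma em_value_indep (a : R) (m m' : nat) (w : R) :
  0 < a -> (m <= m')%nat -> 0 < w + INR (S m) -> em_value a m' w = em_value a m w.
Proof.
intros Ha Hm Hw. induction Hm as [|m' Hm IH]; [easy|].
rewrite em_value_succ, IH; try easy.
apply le_INR in Hm. rewrite !S_INR in *. lra.
Qed.

Lemma em_sum_lim (a w : R) (m : nat) :
  0 < a -> 0 < w -> is_lim_seq (fun n => em_sum m w (INR (S n) + a)) 0.
Proof.
intros Ha Hw. unfold em_sum.
assert (H : forall k, is_lim_seq (fun n =>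
  (-1) ^ k * bern_coef k * power_diff w k (INR (S n) + a)) 0).
{ intros k. replace 0 with ((-1) ^ k * bern_coef k * 0) by ring.
  apply (is_lim_seq_scal_l _ _ 0). apply power_diff_lim; [easy|].
  pose proof (pos_INR k). lra. }
induction m as [|m IH]; [apply H|].
replace 0 with (0 + 0) by ring. now apply is_lim_seq_plus'.
Qed.

Lemma em_value_series (a : R) (m : nat) (w : R) :
  0 < a -> 0 < w ->
  is_series (fun n => power_diff w 1 (INR n + a)) (em_value a m w).
Proof.
intros Ha Hw.
assert (Hw' : 0 < w + INR (S m)) by (pose proof (pos_INR (S m)); lra).
pose proof (is_lim_seq_minus' _ _ _ _ (em_value_lim a m w Ha Hw')
  (em_sum_lim a w (S m) Ha Hw)) as H.
rewrite Rminus_0_r in H. eapply filterlim_ext; [|exact H].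
intros n. apply Rplus_minus_r.
Qed.

Lemma rpoch_0 (k : nat) : rpoch 0 (S k) = 0.
Proof. induction k as [|k IH]; simpl in *; [|rewrite IH]; ring. Qed.

Lemma em_value_0 (a : R) (m : nat) : 0 < a -> em_value a m 0 = 1.
Proof.
intros Ha. unfold em_value. rewrite rpoch_0. unfold em_sum.
rewrite decomp_sum by lia. simpl (pred (S m)).
rewrite (sum_eq _ (fun _ => 0)).
- rewrite sum_cte, bern_coef_0. unfold power_diff. simpl.
  rewrite Ropp_0, Rminus_0_r, Rpower_O by easy. ring.
- intros k _. unfold power_diff. rewrite rpoch_0. ring.
Qed.

(** * Power series expansion of the real continuation *)

Definition pseries_on (r : R) (f : R -> R) : Prop :=
  exists c, forall w, Rabs w < r -> is_pseries c w (f w).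

Lemma pseries_on_ext (r : R) (f g : R -> R) :
  (forall w, f w = g w) -> pseries_on r f -> pseries_on r g.
Proof. intros E [c Hc]. exists c. intros w Hw. rewrite <- E. now apply Hc. Qed.

Lemma pseries_on_plus (r : R) (f g : R -> R) :
  pseries_on r f -> pseries_on r g -> pseries_on r (fun w => f w + g w).
Proof.
intros [c Hc] [d Hd]. exists (PS_plus c d). intros w Hw.
apply (is_pseries_plus (V := R_NormedModule)); auto.
Qed.

Lemma pseries_on_scal (r k : R) (f : R -> R) :
  pseries_on r f -> pseries_on r (fun w => k * f w).
Proof.
intros [c Hc]. exists (PS_scal k c). intros w Hw.
apply (is_pseries_scal (V := R_NormedModule)); [apply Rmult_comm|auto].
Qed.

Lemma pseries_on_mult_id (r : R) (f : R -> R) :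
  pseries_on r f -> pseries_on r (fun w => w * f w).
Proof.
intros [c Hc]. exists (PS_incr_1 c). intros w Hw.
apply (is_pseries_incr_1 (V := R_NormedModule)); auto.
Qed.

Lemma pseries_on_rpoch (r : R) (k : nat) (f : R -> R) :
  pseries_on r f -> pseries_on r (fun w => rpoch w k * f w).
Proof.
intros H. induction k as [|k IH].
- apply pseries_on_ext with f; [intros w; simpl; ring|easy].
- apply pseries_on_ext with
    (fun w => w * (rpoch w k * f w) + INR k * (rpoch w k * f w)).
  { intros w. simpl. ring. }
  apply pseries_on_plus; [now apply pseries_on_mult_id|now apply pseries_on_scal].
Qed.

Lemma pseries_on_Rpower (r sigma y : R) :
  pseries_on r (fun w => Rpower y (- w - sigma)).
Proof.
apply pseries_on_ext with (fun w => Rpower y (- sigma) * exp (w * - ln y)).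
{ intros w. unfold Rpower. rewrite <- exp_plus. f_equal. ring. }
apply pseries_on_scal.
exists (fun k => (- ln y) ^ k * / INR (fact k)). intros w _.
apply is_pseries_R.
eapply is_series_ext; [|exact (proj1 (is_pseries_R _ _ _) (is_exp_Reals (w * - ln y)))].
intros n. cbv beta. rewrite Rpow_mult_distr. apply Rminus_diag_uniq. ring.
Qed.

Lemma pseries_on_em_sum (r : R) (m : nat) (y : R) :
  pseries_on r (fun w => em_sum m w y).
Proof.
unfold em_sum.
assert (H : forall k, pseries_on r (fun w => (-1) ^ k * bern_coef k * power_diff w k y)).
{ intros k. apply pseries_on_scal. unfold power_diff.
  apply pseries_on_rpoch, pseries_on_Rpower. }
induction m as [|m IH]; [apply H|]. exact (pseries_on_plus _ _ _ IH (H (S m))).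
Qed.

Definition em_int_coef (m k : nat) (x : R) : R :=
  RInt (fun t => bern_poly m t * log_weight (INR m + 1) k (x + t)) 0 1.

Lemma is_RInt_em_int_coef (m k : nat) (x : R) :
  0 < x ->
  is_RInt (fun t => bern_poly m t * log_weight (INR m + 1) k (x + t)) 0 1
          (em_int_coef m k x).
Proof.
intros Hx. unfold em_int_coef.
apply (RInt_correct (V := R_CompleteNormedModule)), ex_RInt_continuous.
rewrite Rmin_left, Rmax_right by lra. intros t Ht.
apply (continuous_mult (bern_poly m)); [apply continuous_bern_poly|].
apply (ex_derive_continuous (V := R_NormedModule)).
unfold log_weight, Rpower. auto_derive. lra.
Qed.

Lemma is_RInt_em_int_taylor (m j : nat) (w x : R) :
  0 < x ->
  is_RInt (fun t => bern_poly m t *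
      sum_n (fun k => w ^ k * log_weight (INR m + 1) k (x + t)) j) 0 1
    (sum_n (fun k => scal (pow_n w k) (em_int_coef m k x)) j).
Proof.
intros Hx.
assert (H : forall k, is_RInt (fun t => bern_poly m t *
    (w ^ k * log_weight (INR m + 1) k (x + t))) 0 1
    (scal (pow_n w k) (em_int_coef m k x))).
{ intros k.
  apply is_RInt_ext with (f := fun t =>
    scal (pow_n w k) (bern_poly m t * log_weight (INR m + 1) k (x + t))).
  { intros t _. rewrite pow_n_pow. unfold scal; simpl. unfold mult; simpl. ring. }
  apply (is_RInt_scal (V := R_NormedModule)). now apply is_RInt_em_int_coef. }
induction j as [|j IH].
- rewrite sum_O. eapply is_RInt_ext; [|apply (H O)].
  intros t _. now rewrite sum_O.
- rewrite sum_Sn.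
  eapply is_RInt_ext; [|apply (is_RInt_plus (V := R_NormedModule) _ _ _ _ _ _ IH (H (S j)))].
  intros t _. rewrite sum_Sn. unfold plus; simpl. ring.
Qed.

(** The Taylor remainders of the integrands in [w] carry over to the integrals, and
    their bounds remain summable over [n]. *)
Lemma pseries_on_em_int_series (a : R) (m : nat) :
  0 < a ->
  pseries_on (INR m) (fun w => Series (fun n => em_int m w (INR n + a))).
Proof.
intros Ha. destruct (bern_int_bound m) as [B [HB Hint]].
exists (fun k => Series (fun n => em_int_coef m k (INR n + a))).
intros w Hw.
assert (Hm : 0 < INR m) by (pose proof (Rabs_pos w); lra).
assert (Hy : forall n, 0 < INR n + a) by (intros n; pose proof (pos_INR n); lra).
(* Any [r] strictly between [Rabs w] and [INR m] gives a geometric rate. *)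
set (r := (Rabs w + INR m) / 2). set (rho := Rabs w / r).
assert (Hr : 0 < r < INR m /\ Rabs w < r) by (pose proof (Rabs_pos w); unfold r; lra).
assert (Hwr : Rabs w = rho * r) by (unfold rho; field; lra).
assert (Hrho : 0 <= rho < 1).
{ split.
  - apply Rdiv_le_0_compat; [apply Rabs_pos|lra].
  - apply Rmult_lt_reg_r with r; lra. }
apply (is_pseries_sum_of_remainders (V := R_NormedModule)
  (fun n => em_int m w (INR n + a)) _ (fun n k => em_int_coef m k (INR n + a)) _ w
  (fun n => B * two_powers (INR m + 1) r (INR n + a)) rho).
- apply Series_correct, ex_series_em_int; [easy|].
  pose proof (Rle_abs (- w)). rewrite Rabs_Ropp in *. lra.
- apply (ex_series_scal (V := R_NormedModule)), ex_series_two_powers; lra.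
- exact Hrho.
- intros k. apply Series_correct.
  apply (ex_series_le (K := R_AbsRing) (V := R_CompleteNormedModule) _
    (fun n => B * ((/ r) ^ k * two_powers (INR m + 1) r (INR n + a)))).
  + intros n. assert (Hrk : 0 <= (/ r) ^ k).
    { apply pow_le, Rlt_le, Rinv_0_lt_compat. lra. }
    apply (Hint (fun t => log_weight (INR m + 1) k (INR n + a + t))).
    * apply Rmult_le_pos; [easy|apply Rlt_le, two_powers_pos].
    * intros t Ht. eapply Rle_trans; [apply (log_weight_bound _ r); lra|].
      apply Rmult_le_compat_l; [easy|]. specialize (Hy n).
      apply two_powers_le; lra.
    * apply is_RInt_em_int_coef, Hy.
  + apply (ex_series_scal (V := R_NormedModule)), (ex_series_scal (V := R_NormedModule)).
    apply ex_series_two_powers; lra.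
- intros n j. specialize (Hy n).
  assert (Htp := two_powers_pos (INR m + 1) r (INR n + a)).
  assert (Hrj : 0 <= rho ^ S j) by (apply pow_le; lra).
  apply Rle_trans with (B * (rho ^ S j * two_powers (INR m + 1) r (INR n + a))).
  + apply (Hint (fun t => Rpower (INR n + a + t) (- (w + INR m + 1))
      - sum_n (fun k => w ^ k * log_weight (INR m + 1) k (INR n + a + t)) j)).
    * apply Rmult_le_pos; lra.
    * intros t Ht. rewrite (Rplus_assoc w).
      eapply Rle_trans; [apply (Rpower_remainder_bound _ r rho); lra|].
      apply Rmult_le_compat_l; [easy|]. apply two_powers_le; lra.
    * eapply is_RInt_ext; [|apply (is_RInt_minus (V := R_NormedModule) _ _ _ _ _ _
        (is_RInt_em_int m w (INR n + a) Hy) (is_RInt_em_int_taylor m j w (INR n + a) Hy))].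
      intros t _. unfold minus, plus, opp; simpl. ring.
  + rewrite (Rmult_assoc B). apply Rmult_le_compat_l; [easy|].
    rewrite Rmult_comm. apply Rmult_le_compat_l; [lra|].
    simpl. rewrite <- (Rmult_1_l (rho ^ j)) at 2.
    apply Rmult_le_compat_r; [apply pow_le|]; lra.
Qed.

Lemma pseries_on_em_value (a : R) (m : nat) :
  0 < a -> pseries_on (INR (S m)) (em_value a m).
Proof.
intros Ha.
apply pseries_on_ext with (fun w => em_sum (S m) w a
  + -1 * (rpoch w (S (S m)) * Series (fun n => em_int (S m) w (INR n + a)))).
{ intros w. unfold em_value. ring. }
apply pseries_on_plus; [apply pseries_on_em_sum|].
now apply pseries_on_scal, pseries_on_rpoch, pseries_on_em_int_series.
Qed.

(** * The Hurwitz zeta function on the complex plane *)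

(** Every order of the formula gives the same Taylor coefficients at 0, on
    discs of unbounded radius, so the continuation is entire. *)
Lemma em_value_entire (a : R) :
  0 < a -> exists c : nat -> R,
    (forall r, 0 <= r -> ex_series (fun k => Rabs (c k) * r ^ k)) /\ c O = 1 /\
    (forall m w, 0 < w + INR (S m) -> is_pseries c w (em_value a m w)).
Proof.
intros Ha. destruct (pseries_on_em_value a 0 Ha) as [c Hc].
assert (Hdisc : forall m w, Rabs w < INR (S m) -> is_pseries c w (em_value a m w)).
{ intros m w Hw. destruct (pseries_on_em_value a m Ha) as [d Hd].
  apply is_pseries_ext with (a := d); [|now apply Hd].
  intros n. symmetry. apply Rminus_diag_uniq.
  change (c n - d n) with (PS_minus c d n).
  apply (pseries_zero_right_coef (PS_minus c d) 1 Rlt_0_1). intros t Ht.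
  replace 0 with (minus (em_value a 0 t) (em_value a m t)).
  - apply (is_pseries_minus (V := R_NormedModule)).
    + apply Hc. simpl. rewrite Rabs_pos_eq; lra.
    + apply Hd. rewrite Rabs_pos_eq, S_INR by lra. pose proof (pos_INR m). lra.
  - rewrite (em_value_indep a 0 m); try easy; [apply Rminus_diag| lia|simpl; lra]. }
assert (Hall : forall m w, 0 < w + INR (S m) -> is_pseries c w (em_value a m w)).
{ intros m w Hw. destruct (INR_unbounded (Rabs w)) as [n Hn].
  rewrite <- (em_value_indep a m (m + n) w) by (easy || lia).
  apply Hdisc. rewrite S_INR, plus_INR. pose proof (pos_INR m). lra. }
exists c. repeat split.
- intros r Hr. destruct (INR_unbounded (r + 1)) as [n Hn].
  assert (Hcv : Rbar_lt (Rabs r) (CV_radius c)).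
  { apply Rbar_lt_le_trans with (Rabs (r + 1)).
    - simpl. rewrite !Rabs_pos_eq; lra.
    - apply Rbar_not_lt_le. intros Hlt. apply CV_disk_outside in Hlt. apply Hlt.
      apply ex_series_lim_0. exists (em_value a n (r + 1)).
      apply is_pseries_R, Hall. rewrite S_INR. lra. }
  apply CV_disk_inside in Hcv. eapply ex_series_ext; [|exact Hcv].
  intros k. simpl. now rewrite Rabs_mult, <- RPow_abs, (Rabs_pos_eq r).
- rewrite <- PSeries_0. apply is_pseries_unique.
  rewrite <- (em_value_0 a 0 Ha). apply Hall. simpl. lra.
- exact Hall.
Qed.

(** [1 / (z - 1)] plus an entire function; [c] are the coefficients at 1 of
    [(z - 1) zeta(z, a)]. *)
Definition zeta_of_coefs (c : nat -> R) (z : C) : C :=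
  (/ (z - RtoC 1) + entire_sum (fun k => RtoC (c (S k))) (z - RtoC 1))%C.

Lemma entire_coefs_tail (c : nat -> R) :
  (forall r, 0 <= r -> ex_series (fun k => Rabs (c k) * r ^ k)) ->
  entire_coefs (fun k => RtoC (c (S k))).
Proof.
intros Hc r Hr.
apply (ex_series_le (K := R_AbsRing) (V := R_CompleteNormedModule) _
  (fun k => Rabs (c (S k)) * (r + 1) ^ S k)).
- intros k. change (norm ?x) with (Rabs x).
  rewrite Cmod_R, Rabs_pos_eq.
  + apply Rmult_le_compat_l; [apply Rabs_pos|].
    apply Rle_trans with ((r + 1) ^ k); [apply pow_incr; lra|].
    simpl. assert (0 <= (r + 1) ^ k) by (apply pow_le; lra).
    rewrite <- (Rmult_1_l ((r + 1) ^ k)) at 1. apply Rmult_le_compat_r; lra.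
  + apply Rmult_le_pos; [apply Rabs_pos|now apply pow_le].
- apply (ex_series_incr_1 (V := R_NormedModule) (fun k => Rabs (c k) * (r + 1) ^ k)).
  apply Hc. lra.
Qed.

Lemma zeta_of_coefs_real (c : nat -> R) (w l : R) :
  entire_coefs (fun k => RtoC (c (S k))) -> c O = 1 -> w <> 0 ->
  is_pseries c w l -> zeta_of_coefs c (RtoC (1 + w)) = RtoC (l / w).
Proof.
intros Hc Hc0 Hw Hl. unfold zeta_of_coefs.
replace (RtoC (1 + w) - RtoC 1)%C with (RtoC w)
  by (rewrite RtoC_plus; ring).
replace (entire_sum _ _) with (RtoC ((l - 1) / w)).
- rewrite <- RtoC_inv, <- RtoC_plus by easy. f_equal. field. easy.
- symmetry. apply is_series_CSeries.
  assert (H : is_pseries (PS_decr_1 c) w ((l - 1) / w)).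
  { replace ((l - 1) / w) with (scal (/ w) (plus l (opp (c O)))).
    - apply (is_pseries_decr_1 (V := R_NormedModule)); [|easy].
      unfold mult, one; simpl. now field.
    - rewrite Hc0. unfold scal, plus, opp; simpl. unfold mult; simpl. now field. }
  apply is_pseries_R, is_series_RtoC in H.
  eapply is_series_ext; [|exact H]. intros n. unfold PS_decr_1.
  rewrite RtoC_mult, RtoC_pow. apply Cmult_comm.
Qed.

(** The sum is determined by the equation that its shift satisfies. *)
Lemma is_series_geom_C (v : C) :
  Cmod v < 1 -> is_series (fun k => (v ^ k)%C) (/ (RtoC 1 - v))%C.
Proof.
intros Hv.
assert (Hl : is_series (fun k => (v ^ k)%C) (CSeries (fun k => (v ^ k)%C))).
{ apply ex_series_C_le with (fun k => Cmod v ^ k).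
  - intros n. rewrite Cmod_pow. apply Rle_refl.
  - apply ex_series_geom. rewrite Rabs_pos_eq; [easy|apply Cmod_ge_0]. }
set (l := CSeries _) in *.
assert (H1 : is_series (fun k => (v ^ S k)%C) (v * l)%C).
{ exact (is_series_scal (K := C_AbsRing) (V := C_NormedModule) v _ _ Hl). }
assert (H2 : is_series (fun k => (v ^ S k)%C) (l - RtoC 1)%C).
{ apply (is_series_incr_1 (V := C_NormedModule) (fun k => (v ^ k)%C)).
  replace (plus _ _) with l; [exact Hl|].
  change (l = l - RtoC 1 + RtoC 1)%C. ring. }
assert (E := is_series_unique_C _ _ _ H1 H2).
assert (Hv1 : (RtoC 1 - v)%C <> RtoC 0).
{ intros E'. assert (Ev : v = RtoC 1).
  { replace v with (RtoC 1 - (RtoC 1 - v))%C by ring. rewrite E'. ring. }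
  rewrite Ev, Cmod_1 in Hv. lra. }
replace (/ (RtoC 1 - v))%C with l; [exact Hl|].
transitivity (/ (RtoC 1 - v) * (l - v * l))%C; [now field|].
rewrite E. now field.
Qed.

(** The disc of convergence reaches the pole: the comparison with the Dirichlet series
    uses it in full. *)
Lemma zeta_of_coefs_expansion (c : nat -> R) (z0 : C) :
  entire_coefs (fun k => RtoC (c (S k))) -> z0 <> RtoC 1 ->
  exists e : nat -> C, forall u, Cmod u < Cmod (z0 - RtoC 1) ->
    is_pseries e u (zeta_of_coefs c (z0 + u)%C).
Proof.
intros Hc Hz0.
set (b := (z0 - RtoC 1)%C).
assert (Hb : b <> RtoC 0).
{ intros E. apply Hz0. replace z0 with (b + RtoC 1)%C by (unfold b; ring).
  rewrite E. ring. }
destruct (entire_sum_shift _ b Hc) as [e He].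
exists (PS_plus (fun k => (/ b * (- / b) ^ k)%C) e). intros u Hu.
unfold zeta_of_coefs.
replace (z0 + u - RtoC 1)%C with (b + u)%C by (unfold b; ring).
apply (is_pseries_plus (V := C_NormedModule)); [|apply He].
apply is_pseries_C_iff.
assert (Hv : Cmod (- (u / b))%C < 1).
{ rewrite Cmod_opp, Cmod_div by easy.
  assert (0 < Cmod b) by now apply Cmod_gt_0.
  apply Rmult_lt_reg_r with (Cmod b); [easy|]. unfold Rdiv.
  rewrite Rmult_assoc, Rinv_l by lra. fold b in Hu. lra. }
pose proof (is_series_scal (K := C_AbsRing) (V := C_NormedModule) (/ b)%C _ _
  (is_series_geom_C _ Hv)) as H.
assert (Hbu : (b + u)%C <> RtoC 0).
{ intros E. assert (Eu : u = (- b)%C).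
  { replace u with (b + u - b)%C by ring. rewrite E. ring. }
  fold b in Hu. rewrite Eu, Cmod_opp in Hu. lra. }
replace (/ (b + u))%C with (/ b * / (RtoC 1 - - (u / b)))%C.
- eapply is_series_ext; [|exact H]. intros n.
  change (/ b * (- (u / b)) ^ n = u ^ n * (/ b * (- / b) ^ n))%C.
  replace (- (u / b))%C with (u * (- / b))%C by (unfold Cdiv; ring).
  rewrite Cpow_mult_l. ring.
- now field.
Qed.

Lemma zeta_of_coefs_analytic (c : nat -> R) (z0 : C) :
  entire_coefs (fun k => RtoC (c (S k))) -> z0 <> RtoC 1 ->
  analytic_at (zeta_of_coefs c) z0.
Proof.
intros Hc Hz0. destruct (zeta_of_coefs_expansion c z0 Hc Hz0) as [e He].
assert (Hr : 0 < Cmod (z0 - RtoC 1)).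
{ apply Cmod_gt_0. intros E. apply Hz0.
  replace z0 with (z0 - RtoC 1 + RtoC 1)%C by ring. rewrite E. ring. }
exists e, (mkposreal _ Hr). intros z Hz.
replace z with (z0 + (z - z0))%C at 2 by ring. now apply He.
Qed.

Definition zeta_numerator (c : nat -> R) (z : C) : C :=
  (RtoC 1 + (z - RtoC 1) * entire_sum (fun k => RtoC (c (S k))) (z - RtoC 1))%C.

Lemma zeta_numerator_eq (c : nat -> R) (z : C) :
  z <> RtoC 1 -> zeta_of_coefs c z = (zeta_numerator c z / (z - RtoC 1))%C.
Proof.
intros Hz. unfold zeta_of_coefs, zeta_numerator. field.
intros E. apply Hz. replace z with (z - RtoC 1 + RtoC 1)%C by ring. rewrite E. ring.
Qed.

Lemma zeta_numerator_expansion (c : nat -> R) (u : C) :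
  entire_coefs (fun k => RtoC (c (S k))) -> c O = 1 ->
  is_pseries (fun k => RtoC (c k)) u (zeta_numerator c (RtoC 1 + u)%C).
Proof.
intros Hc Hc0. apply is_pseries_C_iff. unfold zeta_numerator.
replace (RtoC 1 + u - RtoC 1)%C with u by ring.
apply (is_series_decr_1 (V := C_NormedModule)).
pose proof (is_series_scal (K := C_AbsRing) (V := C_NormedModule) u _ _
  (entire_sum_spec _ u Hc)) as H.
match goal with |- is_series _ ?x =>
  replace x with (scal u (entire_sum (fun k => RtoC (c (S k))) u)) end.
- eapply is_series_ext; [|exact H]. intros n.
  change (u * (u ^ n * RtoC (c (S n))) = u ^ S n * RtoC (c (S n)))%C.
  rewrite Cpow_S. ring.
- rewrite Hc0. set (E := entire_sum _ _).
  change (u * E = RtoC 1 + u * E + - (u ^ 0 * RtoC 1))%C. simpl. ring.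
Qed.

Lemma zeta_of_coefs_simple_pole (c : nat -> R) :
  entire_coefs (fun k => RtoC (c (S k))) -> c O = 1 ->
  simple_pole_at (zeta_of_coefs c) (RtoC 1).
Proof.
intros Hc Hc0. exists (zeta_numerator c). repeat split.
- exists (fun k => RtoC (c k)), (mkposreal 1 Rlt_0_1). intros z _.
  replace z with (RtoC 1 + (z - RtoC 1))%C at 2 by ring.
  now apply zeta_numerator_expansion.
- unfold zeta_numerator.
  replace (RtoC 1 - RtoC 1)%C with (RtoC 0) by ring.
  rewrite Cmult_0_l, Cplus_0_r. intros E. apply (f_equal Re) in E. simpl in E. lra.
- exists (mkposreal 1 Rlt_0_1). intros z Hz _. now apply zeta_numerator_eq.
Qed.

Lemma Cpower_real_base (y : R) (z : C) :
  0 < y -> Cpower (RtoC y) z = Cexp (z * RtoC (ln y)).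
Proof.
intros Hy. unfold Cpower. f_equal. f_equal.
unfold Clog. rewrite Cmod_R, Rabs_pos_eq by lra.
unfold RtoC at 2. f_equal. unfold Carg. simpl.
destruct (Rle_dec 0 0) as [_|n]; [|exfalso; lra].
rewrite Cmod_R, Rabs_pos_eq by lra.
replace (y / y) with 1 by (field; lra). apply acos_1.
Qed.

(** A Dirichlet series with positive bases is a power series about a real point
    [sigma], throughout the disc that reaches the line of abscissa 1. *)
Lemma dirichlet_expansion (a sigma : R) :
  0 < a -> exists e : nat -> C, forall u, Cmod u < sigma - 1 ->
    exists l, is_pseries e u l /\
      is_series (fun n => Cpower (RtoC (INR n) + RtoC a) (- (RtoC sigma + u))%C) l.
Proof.
intros Ha.
exists (fun k => RtoC (Series (fun n => log_weight sigma k (INR n + a)))).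
intros u Hu.
assert (Hy : forall n, 0 < INR n + a) by (intros n; pose proof (pos_INR n); lra).
pose proof (Cmod_ge_0 u) as Hu0.
set (r := (Cmod u + (sigma - 1)) / 2). set (rho := Cmod u / r).
assert (Hr : 0 < r < sigma - 1 /\ Cmod u < r) by (unfold r; lra).
assert (Hur : Cmod u = rho * r) by (unfold rho; field; lra).
assert (Hrho : 0 <= rho < 1).
{ split.
  - apply Rdiv_le_0_compat; lra.
  - apply Rmult_lt_reg_r with r; lra. }
set (phi := fun n => (RtoC (Rpower (INR n + a) (- sigma))
                      * Cexp (u * RtoC (- ln (INR n + a))))%C).
assert (Hphi : forall n, phi n
    = Cpower (RtoC (INR n) + RtoC a) (- (RtoC sigma + u))%C).
{ intros n. unfold phi. rewrite <- RtoC_plus, Cpower_real_base by apply Hy.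
  unfold Rpower. rewrite <- Cexp_RtoC, <- Cexp_plus. f_equal.
  rewrite RtoC_mult, !RtoC_opp. ring. }
assert (Hsum : is_series phi (CSeries phi)).
{ apply ex_series_C_le with (fun n => two_powers sigma r (INR n + a)).
  - intros n. unfold phi.
    rewrite Cmod_mult, Cmod_R, Rabs_pos_eq, Cmod_Cexp by apply Rlt_le, Rpower_pos.
    eapply Rle_trans; [|apply Rpower_exp_abs_ln_le].
    apply Rmult_le_compat_l; [apply Rlt_le, Rpower_pos|].
    assert (H : Re (u * RtoC (- ln (INR n + a)))%C <= r * Rabs (ln (INR n + a))).
    { eapply Rle_trans; [apply Rle_abs|]. eapply Rle_trans; [apply re_le_Cmod|].
      rewrite Cmod_mult, Cmod_R, Rabs_Ropp.
      apply Rmult_le_compat_r; [apply Rabs_pos|lra]. }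
    destruct H as [H| ->]; [apply Rlt_le, exp_increasing, H|apply Rle_refl].
  - apply ex_series_two_powers; lra. }
exists (CSeries phi). split.
- apply (is_pseries_sum_of_remainders (V := C_NormedModule) phi _
    (fun n k => RtoC (log_weight sigma k (INR n + a))) _ u
    (fun n => two_powers sigma r (INR n + a)) rho).
  + exact Hsum.
  + apply ex_series_two_powers; lra.
  + exact Hrho.
  + intros k. apply is_series_RtoC, Series_correct.
    apply (ex_series_le (K := R_AbsRing) (V := R_CompleteNormedModule) _
      (fun n => (/ r) ^ k * two_powers sigma r (INR n + a))).
    * intros n. apply log_weight_bound. lra.
    * apply (ex_series_scal (V := R_NormedModule)), ex_series_two_powers; lra.
  + intros n m. eapply Rle_trans; [|apply Rle_trans with
      (rho ^ S m * two_powers sigma r (INR n + a))].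
    * apply Req_le. apply (f_equal Cmod). unfold phi.
      apply (f_equal (fun w => (RtoC (Rpower (INR n + a) (- sigma))
                      * Cexp (u * RtoC (- ln (INR n + a))) - w)%C)).
      apply sum_n_ext. intros k.
      exact (f_equal (fun w => Cmult w (RtoC (log_weight sigma k (INR n + a))))
        (pow_n_Cpow u k)).
    * apply Cpower_remainder_bound; lra.
    * rewrite Rmult_comm. apply Rmult_le_compat_l; [apply Rlt_le, two_powers_pos|].
      simpl. rewrite <- (Rmult_1_l (rho ^ m)) at 2.
      apply Rmult_le_compat_r; [apply pow_le|]; lra.
- eapply is_series_ext; [exact Hphi|exact Hsum].
Qed.

(** Discs with real centres, tangent to the line of abscissa 1 on its right, exhaust
    the half-plane. *)
Lemma disc_through_half_plane (z : C) :
  1 < Re z -> exists sigma, 1 < sigma /\ Cmod (z - RtoC sigma) < sigma - 1.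
Proof.
destruct z as [x y]. intros Hx. unfold Re in Hx; simpl in Hx.
(* The condition on [sigma] is [Re z ^ 2 + Im z ^ 2 - 1 < 2 * sigma * (Re z - 1)]. *)
set (q := (x * x + y * y) / (x - 1)).
assert (Hq : q * (x - 1) = x * x + y * y) by (unfold q; field; lra).
assert (Hq0 : 0 < q).
{ apply Rdiv_lt_0_compat; [|lra].
  assert (0 < x * x) by (apply Rmult_lt_0_compat; lra).
  assert (0 <= y * y) by apply Rle_0_sqr. lra. }
exists (1 + q). split; [lra|].
apply Rsqr_incrst_0; [|apply Cmod_ge_0|lra].
unfold Rsqr. pose proof (Cmod2_alt ((x, y) - RtoC (1 + q))%C) as E.
simpl in E. rewrite !Rmult_1_r in E. rewrite E.
assert (0 <= x * x + y * y).
{ pose proof (Rle_0_sqr x). pose proof (Rle_0_sqr y). unfold Rsqr in *. lra. }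
nra.
Qed.

(** About a real point, both sides are power series on the same disc and agree at its
    real points on the right of the centre. *)
Lemma zeta_of_coefs_dirichlet (a : R) (c : nat -> R) :
  0 < a ->
  entire_coefs (fun k => RtoC (c (S k))) -> c O = 1 ->
  (forall m w, 0 < w + INR (S m) -> is_pseries c w (em_value a m w)) ->
  forall s : C, 1 < Re s ->
  is_series (fun n => Cpower (RtoC (INR n) + RtoC a) (- s)%C) (zeta_of_coefs c s).
Proof.
intros Ha Hc Hc0 Hem s Hs.
destruct (disc_through_half_plane s Hs) as [sigma [Hsigma Hdisc]].
destruct (dirichlet_expansion a sigma Ha) as [e He].
assert (Hs1 : RtoC sigma <> RtoC 1).
{ intros E. apply (f_equal Re) in E. simpl in E. lra. }
destruct (zeta_of_coefs_expansion c (RtoC sigma) Hc Hs1) as [e' He'].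
assert (Hmod : Cmod (RtoC sigma - RtoC 1) = sigma - 1).
{ rewrite <- RtoC_minus, Cmod_R, Rabs_pos_eq; lra. }
rewrite Hmod in He'.
assert (Hee' : forall n, e n = e' n).
{ apply (pseries_coef_unique e e' (fun t => zeta_of_coefs c (RtoC sigma + RtoC t)%C)
    (sigma - 1)); [lra| |].
  - intros t Ht. destruct (He (RtoC t)) as [l [Hl1 Hl2]].
    { rewrite Cmod_R, Rabs_pos_eq; lra. }
    replace (zeta_of_coefs c (RtoC sigma + RtoC t)%C) with l; [exact Hl1|].
    set (w := sigma + t - 1). assert (Hw : 0 < w) by (unfold w; lra).
    rewrite <- RtoC_plus. replace (sigma + t) with (1 + w) by (unfold w; ring).
    rewrite (zeta_of_coefs_real c w (em_value a 0 w)); try easy; try lra.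
    2:{ apply Hem. simpl. lra. }
    apply (is_series_unique_C _ _ _ Hl2).
    pose proof (is_series_scal_r (/ w) _ _ (em_value_series a 0 w Ha Hw)) as H.
    apply is_series_RtoC in H. eapply is_series_ext; [|exact H].
    intros n. pose proof (pos_INR n).
    rewrite <- RtoC_plus, <- RtoC_plus, Cpower_real_base by lra.
    rewrite <- RtoC_opp, <- RtoC_mult, Cexp_RtoC. f_equal.
    unfold power_diff. simpl (rpoch w 1). simpl (INR 1).
    replace (1 * (w + 0) * Rpower (INR n + a) (- w - 1) * / w)
      with (Rpower (INR n + a) (- w - 1)) by (field; lra).
    unfold Rpower. f_equal. unfold w. ring.
  - intros t Ht. apply He'. rewrite Cmod_R, Rabs_pos_eq; lra. }
destruct (He _ Hdisc) as [l [Hl1 Hl2]].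
replace (RtoC sigma + (s - RtoC sigma))%C with s in Hl2 by ring.
replace (zeta_of_coefs c s) with l; [exact Hl2|].
specialize (He' _ Hdisc).
replace (RtoC sigma + (s - RtoC sigma))%C with s in He' by ring.
apply (is_series_unique_C _ _ _ Hl1).
eapply is_pseries_ext; [|exact He']. intros n. symmetry. apply Hee'.
Qed.

Lemma zeta_of_coefs_is_hurwitz_zeta (a : R) (c : nat -> R) :
  0 < a ->
  entire_coefs (fun k => RtoC (c (S k))) -> c O = 1 ->
  (forall m w, 0 < w + INR (S m) -> is_pseries c w (em_value a m w)) ->
  is_hurwitz_zeta (RtoC a) (zeta_of_coefs c).
Proof.
intros Ha Hc Hc0 Hem. repeat split.
- now apply zeta_of_coefs_dirichlet.
- intros s Hs. now apply zeta_of_coefs_analytic.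
- now apply zeta_of_coefs_simple_pole.
Qed.

(** * Uniqueness of the continuation on the real line *)

(** The analytic numerators at the pole agree on the right of 1, hence on its left. *)
Lemma simple_pole_determined_from_right (f g : C -> C) :
  simple_pole_at f (RtoC 1) -> simple_pole_at g (RtoC 1) ->
  (forall t, 1 < t -> f (RtoC t) = g (RtoC t)) ->
  exists r, 0 < r /\ forall t, 1 - r < t < 1 -> f (RtoC t) = g (RtoC t).
Proof.
intros [F [[cF [rF HF]] [_ [rF' HF']]]] [G [[cG [rG HG]] [_ [rG' HG']]]] Hfg.
set (r := Rmin (Rmin rF rF') (Rmin rG rG')).
assert (Hr : 0 < r).
{ pose proof (cond_pos rF). pose proof (cond_pos rF').
  pose proof (cond_pos rG). pose proof (cond_pos rG').
  repeat apply Rmin_glb_lt; easy. }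
assert (Hle : r <= rF /\ r <= rF' /\ r <= rG /\ r <= rG').
{ unfold r. repeat split.
  - eapply Rle_trans; [apply Rmin_l|apply Rmin_l].
  - eapply Rle_trans; [apply Rmin_l|apply Rmin_r].
  - eapply Rle_trans; [apply Rmin_r|apply Rmin_l].
  - eapply Rle_trans; [apply Rmin_r|apply Rmin_r]. }
assert (Hsub : forall u, (RtoC (1 + u) - RtoC 1)%C = RtoC u)
  by (intros u; rewrite RtoC_plus; ring).
assert (Hne : forall u, u <> 0 -> RtoC (1 + u) <> RtoC 1).
{ intros u Hu E. apply (f_equal Re) in E. simpl in E. lra. }
assert (HFs : forall u, Rabs u < r -> is_pseries cF (RtoC u) (F (RtoC (1 + u)))).
{ intros u Hu. rewrite <- (Hsub u). apply HF. rewrite Hsub, Cmod_R. lra. }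
assert (HGs : forall u, Rabs u < r -> is_pseries cG (RtoC u) (G (RtoC (1 + u)))).
{ intros u Hu. rewrite <- (Hsub u). apply HG. rewrite Hsub, Cmod_R. lra. }
assert (HfF : forall u, u <> 0 -> Rabs u < r ->
  f (RtoC (1 + u)) = (F (RtoC (1 + u)) / RtoC u)%C).
{ intros u Hu0 Hu. rewrite <- (Hsub u). apply HF'; [now apply Hne|].
  rewrite Hsub, Cmod_R. lra. }
assert (HgG : forall u, u <> 0 -> Rabs u < r ->
  g (RtoC (1 + u)) = (G (RtoC (1 + u)) / RtoC u)%C).
{ intros u Hu0 Hu. rewrite <- (Hsub u). apply HG'; [now apply Hne|].
  rewrite Hsub, Cmod_R. lra. }
assert (Hu0 : forall u, u <> 0 -> RtoC u <> RtoC 0).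
{ intros u Hu E. apply (f_equal Re) in E. simpl in E. lra. }
assert (Hc : forall n, cF n = cG n).
{ apply (pseries_coef_unique cF cG (fun u => F (RtoC (1 + u))) r Hr).
  - intros t Ht. apply HFs. rewrite Rabs_pos_eq; lra.
  - intros t Ht.
    assert (Ht' : Rabs t < r) by (rewrite Rabs_pos_eq; lra).
    assert (Ht0 : t <> 0) by lra.
    replace (F (RtoC (1 + t))) with (G (RtoC (1 + t))); [now apply HGs|].
    replace (G (RtoC (1 + t))) with (g (RtoC (1 + t)) * RtoC t)%C
      by (rewrite HgG by easy; field; now apply Hu0).
    rewrite <- Hfg by lra. rewrite HfF by easy. field. now apply Hu0. }
exists r. split; [easy|]. intros t Ht.
replace t with (1 + (t - 1)) by ring.
assert (Ht' : Rabs (t - 1) < r) by (rewrite Rabs_left; lra).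
assert (Ht0 : t - 1 <> 0) by lra.
rewrite HfF, HgG by easy. f_equal.
apply (is_series_unique_C _ _ _ (HFs _ Ht')).
eapply is_pseries_ext; [|apply (HGs _ Ht')]. intros n. now rewrite Hc.
Qed.

(** The half-line of convergence of the Dirichlet series is separated from the other
    real points by the pole, so the comparison crosses 1 by the numerators and then
    continues to the left by the identity theorem. *)
Lemma hurwitz_zeta_unique_on_reals (a : C) (f g : C -> C) :
  is_hurwitz_zeta a f -> is_hurwitz_zeta a g ->
  forall t, t <> 1 -> f (RtoC t) = g (RtoC t).
Proof.
intros [Hf1 [Hf2 Hf3]] [Hg1 [Hg2 Hg3]].
assert (Hright : forall t, 1 < t -> f (RtoC t) = g (RtoC t)).
{ intros t Ht. apply (is_series_unique_C _ _ _ (Hf1 (RtoC t) Ht) (Hg1 (RtoC t) Ht)). }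
destruct (simple_pole_determined_from_right f g Hf3 Hg3 Hright) as [r [Hr Hleft]].
assert (H : forall t, t < 1 -> (f (RtoC t) - g (RtoC t))%C = RtoC 0).
{ apply (identity_theorem_real_line (fun t => f (RtoC t) - g (RtoC t))%C 1 (1 - r)).
  - lra.
  - intros t Ht. rewrite Hleft by easy. ring.
  - intros t Ht.
    assert (Hne : RtoC t <> RtoC 1).
    { intros E. apply (f_equal Re) in E. simpl in E. lra. }
    destruct (Hf2 _ Hne) as [cf [rf Hcf]]. destruct (Hg2 _ Hne) as [cg [rg Hcg]].
    assert (Hm : 0 < Rmin rf rg) by (apply Rmin_glb_lt; apply cond_pos).
    exists (PS_minus cf cg), (mkposreal _ Hm). simpl. intros u Hu.
    pose proof (Rmin_l rf rg). pose proof (Rmin_r rf rg).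
    assert (E : (RtoC (t + u) - RtoC t)%C = RtoC u) by (rewrite RtoC_plus; ring).
    apply (is_pseries_minus (V := C_NormedModule)); rewrite <- E.
    + apply Hcf. rewrite E, Cmod_R. lra.
    + apply Hcg. rewrite E, Cmod_R. lra. }
intros t Ht. destruct (Rtotal_order t 1) as [Hlt|[Heq|Hgt]]; [|easy|now apply Hright].
replace (f (RtoC t)) with (f (RtoC t) - g (RtoC t) + g (RtoC t))%C by ring.
rewrite H by easy. ring.
Qed.

Lemma hurwitz_zeta_real (a : R) (m : nat) (w : R) :
  0 < a -> w <> 0 -> 0 < w + INR (S m) ->
  hurwitz_zeta (RtoC (1 + w)) (RtoC a) = RtoC (em_value a m w / w).
Proof.
intros Ha Hw Hm. destruct (em_value_entire a Ha) as [c [Hc [Hc0 Hem]]].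
apply entire_coefs_tail in Hc.
pose proof (zeta_of_coefs_is_hurwitz_zeta a c Ha Hc Hc0 Hem) as Hz.
rewrite <- (zeta_of_coefs_real c w) by auto.
unfold hurwitz_zeta. apply (hurwitz_zeta_unique_on_reals (RtoC a)); [|exact Hz|lra].
apply epsilon_spec. now exists (zeta_of_coefs c).
Qed.

(** * Sign of the remainder *)

Definition em_kernel_int (M : nat) (w x : R) : R :=
  RInt (fun t => em_kernel M t * Rpower (x + t) (- w - INR (S (S (S (2 * M)))))) 0 1.

Lemma continuous_em_kernel_Rpower (M : nat) (sigma x t : R) :
  0 < x + t -> continuous (fun u => em_kernel M u * Rpower (x + u) sigma) t.
Proof.
intros H. apply (continuous_mult (em_kernel M) (fun u => Rpower (x + u) sigma)).
- apply (continuous_minus (fun _ => bern_coef (S (S (2 * M))))).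
  + apply continuous_const.
  + apply continuous_bern_poly.
- apply (ex_derive_continuous (V := R_NormedModule)).
  eexists. now apply is_derive_Rpower_shift.
Qed.

Lemma em_kernel_int_sign (M : nat) (w x : R) :
  0 < x -> 0 < (-1) ^ M * em_kernel_int M w x.
Proof.
intros Hx. unfold em_kernel_int.
set (f := fun t => em_kernel M t * Rpower (x + t) (- w - INR (S (S (S (2 * M)))))).
assert (Hcont : forall t, 0 <= t <= 1 -> continuous f t).
{ intros t Ht. apply continuous_em_kernel_Rpower. lra. }
change (0 < scal ((-1) ^ M) (RInt (V := R_CompleteNormedModule) f 0 1)).
rewrite <- (RInt_scal (V := R_CompleteNormedModule) f 0 1 ((-1) ^ M)).
- apply RInt_gt_0; [lra| |].
  + intros t Ht. unfold scal; simpl. unfold mult; simpl. unfold f.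
    rewrite <- Rmult_assoc. apply Rmult_lt_0_compat; [|apply Rpower_pos].
    now apply em_kernel_sign.
  + intros t Ht. apply (continuous_scal_r (V := R_NormedModule)). now apply Hcont.
- apply ex_RInt_continuous. rewrite Rmin_left, Rmax_right by lra. exact Hcont.
Qed.

Lemma em_sum_even (M : nat) (w y : R) :
  em_sum (S (S (2 * M))) w y =
  em_sum (S (2 * M)) w y + bern_coef (S (S (2 * M))) * power_diff w (S (S (2 * M))) y.
Proof.
unfold em_sum. rewrite (tech5 _ (S (2 * M))), bern_coef_sign. reflexivity.
Qed.

Lemma em_sum_odd (M : nat) (w y : R) :
  em_sum (S (2 * S M)) w y =
  em_sum (S (2 * M)) w y + bern_coef (S (S (2 * M))) * power_diff w (S (S (2 * M))) y.
Proof.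
rewrite <- em_sum_even. replace (S (2 * S M)) with (S (S (S (2 * M)))) by lia.
unfold em_sum. rewrite (tech5 _ (S (S (2 * M)))).
replace (bern_coef (S (S (S (2 * M))))) with 0; [ring|].
rewrite <- (bern_coef_odd M). f_equal. lia.
Qed.

Lemma em_kernel_step (M : nat) (w x : R) :
  0 < x ->
  rpoch w (S (S (S (2 * M)))) * em_kernel_int M w x =
  power_diff w 1 x - em_sum (S (2 * M)) w x + em_sum (S (2 * M)) w (x + 1).
Proof.
intros Hx.
pose proof (is_RInt_em (S (2 * M)) (bern_coef (S (S (2 * M)))) w x Hx) as H.
apply (is_RInt_unique (V := R_CompleteNormedModule)) in H.
rewrite !em_sum_even in H.
match type of H with _ = ?r => replace (power_diff w 1 x - em_sum (S (2 * M)) w x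
  + em_sum (S (2 * M)) w (x + 1)) with r by ring end.
rewrite <- H. unfold em_kernel_int.
set (f := fun t => em_kernel M t * Rpower (x + t) (- w - INR (S (S (S (2 * M)))))).
transitivity (RInt (fun t => scal (rpoch w (S (S (S (2 * M))))) (f t)) 0 1).
- symmetry. apply (RInt_scal (V := R_CompleteNormedModule)).
  apply ex_RInt_continuous. rewrite Rmin_left, Rmax_right by lra.
  intros t Ht. apply continuous_em_kernel_Rpower. lra.
- apply RInt_ext. intros t _. unfold scal, f, em_kernel, power_diff.
  cbn -[rpoch INR Nat.mul]. unfold mult; cbn -[rpoch INR Nat.mul]. ring.
Qed.

Lemma em_kernel_series (a : R) (M : nat) (w : R) :
  0 < a -> 0 < w + INR (S (S (2 * M))) ->
  is_series (fun n => rpoch w (S (S (S (2 * M)))) * em_kernel_int M w (INR n + a))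
            (em_value a (S (2 * M)) w - em_sum (S (2 * M)) w a).
Proof.
intros Ha Hw.
assert (Hsum : forall n,
  sum_n (fun k => rpoch w (S (S (S (2 * M)))) * em_kernel_int M w (INR k + a)) n =
  sum_n (fun k => power_diff w 1 (INR k + a)) n
  + em_sum (S (S (2 * M))) w (INR (S n) + a)
  - bern_coef (S (S (2 * M))) * power_diff w (S (S (2 * M))) (INR (S n) + a)
  - em_sum (S (2 * M)) w a).
{ intros n. rewrite em_sum_even. induction n as [|n IH].
  - rewrite !sum_O, em_kernel_step by (simpl; lra).
    change (INR 0) with 0. change (INR 1) with 1.
    rewrite Rplus_0_l, (Rplus_comm 1 a). apply Rminus_diag_uniq. ring.
  - rewrite !sum_Sn. change (@plus R_AbelianMonoid) with Rplus.
    rewrite IH, em_kernel_step by (pose proof (pos_INR (S n)); lra).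
    rewrite (S_INR (S n)). replace (INR (S n) + 1 + a) with (INR (S n) + a + 1) by ring.
    apply Rminus_diag_uniq. ring. }
unfold is_series. eapply filterlim_ext; [intros n; symmetry; apply Hsum|].
apply (is_lim_seq_minus' _ (fun _ => em_sum (S (2 * M)) w a)); [|apply is_lim_seq_const].
rewrite <- (Rminus_0_r (em_value a (S (2 * M)) w)).
apply is_lim_seq_minus'; [now apply em_value_lim|].
replace 0 with (bern_coef (S (S (2 * M))) * 0) by ring.
apply (is_lim_seq_scal_l _ _ 0). now apply power_diff_lim.
Qed.

Lemma is_series_pos (f : nat -> R) (l : R) :
  (forall n, 0 < f n) -> is_series f l -> 0 < l.
Proof.
intros Hf Hl. apply Rlt_le_trans with (f O); [apply Hf|].
rewrite <- (sum_O f). apply (is_lim_seq_incr_compare (sum_n f) l); [exact Hl|].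
intros n. rewrite sum_Sn. pose proof (Hf (S n)). unfold plus; simpl. lra.
Qed.

(** The factor [rpoch w (2 M + 3)] of the kernel integrals is [rpoch w (2 M + 2)] times
    a positive number, so dividing by the latter leaves the sign of the kernel. *)
Lemma em_remainder_sign (a : R) (M : nat) (w : R) :
  0 < a -> 0 < w + INR (S (S (2 * M))) -> rpoch w (S (S (2 * M))) <> 0 ->
  0 < (-1) ^ M *
      ((em_value a (S (2 * M)) w - em_sum (S (2 * M)) w a) / rpoch w (S (S (2 * M)))).
Proof.
intros Ha Hw Hp.
set (K := w + INR (S (S (2 * M)))) in *.
assert (HK : rpoch w (S (S (S (2 * M)))) = rpoch w (S (S (2 * M))) * K) by reflexivity.
set (D := em_value a (S (2 * M)) w - em_sum (S (2 * M)) w a).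
apply Rmult_lt_reg_r with (/ K); [now apply Rinv_0_lt_compat|]. rewrite Rmult_0_l.
apply (is_series_pos (fun n => (-1) ^ M * em_kernel_int M w (INR n + a))).
- intros n. apply em_kernel_int_sign. pose proof (pos_INR n). lra.
- pose proof (em_kernel_series a M w Ha Hw) as H. rewrite HK in H. fold D in H.
  apply (is_series_scal ((-1) ^ M / (rpoch w (S (S (2 * M))) * K))) in H.
  replace ((-1) ^ M * (D / rpoch w (S (S (2 * M)))) * / K) with
    (scal ((-1) ^ M / (rpoch w (S (S (2 * M))) * K)) D).
  + eapply is_series_ext; [|exact H]. intros n.
    unfold scal; cbn -[rpoch Nat.mul]. unfold mult; cbn -[rpoch Nat.mul].
    field. split; [lra|easy].
  + unfold scal; cbn -[rpoch Nat.mul]. unfold mult; cbn -[rpoch Nat.mul].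
    field. split; [lra|easy].
Qed.

Lemma em_remainder_zero (a : R) (M : nat) (w : R) :
  0 < a -> 0 < w + INR (S (S (2 * M))) -> rpoch w (S (S (2 * M))) = 0 ->
  em_value a (S (2 * M)) w - em_sum (S (2 * M)) w a = 0.
Proof.
intros Ha Hw Hp. pose proof (em_kernel_series a M w Ha Hw) as H.
apply is_series_unique in H. rewrite <- H. apply is_series_unique.
eapply is_series_ext; [|apply (is_series_zero (V := R_NormedModule))].
intros n. cbn -[Nat.mul] in *. rewrite Hp. symmetry. unfold zero; simpl. ring.
Qed.

(** Two consecutive remainders have opposite signs and differ by the term between
    them, which is then larger in absolute value than the first of them.  When
    [rpoch w (2 M + 2)] vanishes, so do the remainder and the term. *)
Lemma em_remainder_fraction (a : R) (M : nat) (w : R) :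
  0 < a -> 0 < w + INR (S (S (2 * M))) ->
  exists theta, 0 < theta < 1 /\
    em_value a (S (2 * M)) w - em_sum (S (2 * M)) w a =
    bern_coef (S (S (2 * M))) * power_diff w (S (S (2 * M))) a * theta.
Proof.
intros Ha Hw. set (p := rpoch w (S (S (2 * M)))).
destruct (Req_dec p 0) as [Hp|Hp].
{ exists (1 / 2). split; [lra|]. rewrite em_remainder_zero by easy.
  unfold power_diff. fold p. rewrite Hp. ring. }
set (D := em_value a (S (2 * M)) w - em_sum (S (2 * M)) w a).
set (b := bern_coef (S (S (2 * M)))).
set (A := Rpower a (- w - INR (S (S (2 * M))))).
assert (HA : 0 < A) by apply Rpower_pos.
assert (H1 : 0 < (-1) ^ M * (D / p)) by now apply em_remainder_sign.
assert (H2 : 0 < (-1) ^ M * (b * A - D / p)).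
{ set (k2 := w + INR (S (S (2 * M)))) in *.
  set (k3 := w + INR (S (S (S (2 * M))))).
  assert (Hk3 : 0 < k3) by (unfold k3, k2 in *; rewrite (S_INR (S (S (2 * M)))); lra).
  assert (Hp' : rpoch w (S (S (2 * S M))) = p * k2 * k3).
  { replace (S (S (2 * S M))) with (S (S (S (S (2 * M))))) by lia. reflexivity. }
  assert (Hpn : p * k2 * k3 <> 0).
  { apply Rmult_integral_contrapositive_currified; [|lra].
    apply Rmult_integral_contrapositive_currified; [exact Hp|lra]. }
  assert (Hw' : 0 < w + INR (S (S (2 * S M)))).
  { replace (S (S (2 * S M))) with (S (S (S (S (2 * M))))) by lia.
    rewrite (S_INR (S (S (S (2 * M))))). unfold k3 in Hk3. lra. }
  pose proof (em_remainder_sign a (S M) w Ha Hw') as H. rewrite Hp' in H.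
  specialize (H Hpn).
  rewrite (em_value_indep a (S (2 * M))), em_sum_odd in H by (easy || lia).
  replace (em_value a (S (2 * M)) w - (em_sum (S (2 * M)) w a
    + bern_coef (S (S (2 * M))) * power_diff w (S (S (2 * M))) a))
    with (D - b * (p * A)) in H by (unfold D, b, p, A, power_diff; ring).
  replace ((-1) ^ M * (b * A - D / p)) with
    ((-1) ^ S M * ((D - b * (p * A)) / (p * k2 * k3)) * (k2 * k3)).
  - apply Rmult_lt_0_compat; [exact H|now apply Rmult_lt_0_compat].
  - simpl. field. repeat split; easy || lra. }
assert (Hb : 0 < (-1) ^ M * (b * A)) by lra.
exists ((-1) ^ M * (D / p) / ((-1) ^ M * (b * A))). split; [split|].
- now apply Rdiv_lt_0_compat.
- apply Rmult_lt_reg_r with ((-1) ^ M * (b * A)); [easy|].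
  unfold Rdiv at 1. rewrite Rmult_assoc, Rinv_l by lra. lra.
- unfold power_diff. fold p A.
  assert (Hs : (-1) ^ M <> 0) by (apply pow_nonzero; lra).
  assert (HbA : b * A <> 0).
  { intros E. rewrite E in Hb. lra. }
  assert (Hb0 : b <> 0).
  { intros E. apply HbA. rewrite E. ring. }
  field. repeat split; easy || lra.
Qed.

(** * From the complex definitions to the real formula *)

Lemma pochhammer_RtoC (s : R) (k : nat) : pochhammer (RtoC s) k = RtoC (rpoch s k).
Proof.
induction k as [|k IH]; [reflexivity|].
simpl. rewrite IH, <- RtoC_plus, <- RtoC_mult. reflexivity.
Qed.

Lemma rpoch_succ_l (w : R) (k : nat) : rpoch w (S k) = w * rpoch (1 + w) k.
Proof.
induction k as [|k IH]; [simpl; ring|].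
change (rpoch w (S (S k))) with (rpoch w (S k) * (w + INR (S k))).
rewrite IH, S_INR. simpl. ring.
Qed.

Lemma Rpower_minus_INR (a c : R) (k : nat) :
  0 < a -> Rpower a (c - INR k) = Rpower a c / a ^ k.
Proof.
intros Ha. unfold Rminus. rewrite Rpower_plus, Rpower_Ropp, Rpower_pow by easy.
reflexivity.
Qed.

Definition real_em_term (s a : R) (n : nat) : R :=
  bern_coef (2 * n) * (rpoch s (2 * n - 1) / a ^ (2 * n)).

Lemma em_term_RtoC (s a : R) (n : nat) :
  0 < a -> em_term (RtoC s) (RtoC a) n = RtoC (real_em_term s a n).
Proof.
intros Ha. unfold em_term, real_em_term, bern_coef.
assert (a ^ (2 * n) <> 0) by (apply pow_nonzero; lra).
rewrite pochhammer_RtoC, <- RtoC_pow, <- RtoC_div, <- RtoC_mult by easy. reflexivity.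
Qed.

Lemma power_diff_em_term (a w : R) (M : nat) :
  0 < a ->
  bern_coef (S (S (2 * M))) * power_diff w (S (S (2 * M))) a =
  w * Rpower a (- w) * real_em_term (1 + w) a (S M).
Proof.
intros Ha. unfold real_em_term, power_diff.
replace (2 * S M - 1)%nat with (S (2 * M)) by lia.
replace (2 * S M)%nat with (S (S (2 * M))) by lia.
rewrite Rpower_minus_INR, rpoch_succ_l by easy. field.
apply pow_nonzero. lra.
Qed.

Lemma em_sum_closed_form (a w : R) (M : nat) :
  0 < a ->
  em_sum (S (2 * M)) w a =
  Rpower a (- w) * (1 + w / (2 * a) + w * sum_n_m (real_em_term (1 + w) a) 1 M).
Proof.
intros Ha. induction M as [|M IH].
- rewrite sum_n_m_zero by lia. unfold em_sum. simpl sum_f_R0.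
  rewrite bern_coef_0, bern_coef_1. unfold power_diff.
  rewrite !Rpower_minus_INR by easy.
  unfold zero; simpl. field. lra.
- rewrite em_sum_odd, IH, power_diff_em_term, sum_n_Sm by (easy || lia).
  change (@plus R_AbelianMonoid) with Rplus. apply Rminus_diag_uniq. ring.
Qed.

Lemma hurwitz_remainder_real (a w : R) (M : nat) :
  0 < a -> w <> 0 -> 0 < w + INR (S (S (2 * M))) ->
  hurwitz_remainder (S M) (RtoC (1 + w)) (RtoC a) =
  RtoC ((em_value a (S (2 * M)) w - em_sum (S (2 * M)) w a) / (w * Rpower a (- w))).
Proof.
intros Ha Hw Hw'. unfold hurwitz_remainder.
rewrite (hurwitz_zeta_real a (S (2 * M)) w Ha Hw Hw').
replace (S M - 1)%nat with M by lia.
replace (sum_n_m (em_term (RtoC (1 + w)) (RtoC a)) 1 M)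
  with (RtoC (sum_n_m (real_em_term (1 + w) a) 1 M)).
2:{ clear Hw'. induction M as [|M IH].
    - now rewrite !sum_n_m_zero by lia.
    - rewrite !sum_n_Sm by lia. rewrite <- IH, em_term_RtoC by easy.
      apply RtoC_plus. }
assert (HT := Rpower_pos a (- w)). set (T := Rpower a (- w)) in *.
assert (E1 : Cpower (RtoC a) (- RtoC (1 + w)) = RtoC (T / a)).
{ rewrite Cpower_real_base, <- RtoC_opp, <- RtoC_mult, Cexp_RtoC by easy.
  f_equal. unfold T. rewrite <- Rpower_pred by easy.
  unfold Rpower. f_equal. ring. }
assert (E2 : Cpower (RtoC a) (RtoC 1 - RtoC (1 + w)) = RtoC T).
{ rewrite Cpower_real_base, <- RtoC_minus, <- RtoC_mult, Cexp_RtoC by easy.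
  f_equal. unfold T, Rpower. f_equal. ring. }
assert (E3 : (RtoC (1 + w) - RtoC 1)%C = RtoC w) by (rewrite RtoC_plus; ring).
rewrite E1, E2, E3, em_sum_closed_form by easy. fold T.
rewrite <- RtoC_mult, <- RtoC_div, <- RtoC_plus, <- RtoC_minus, <- RtoC_div,
  <- RtoC_minus by lra.
f_equal. set (Sg := sum_n_m _ 1 M). field. lra.
Qed.

Theorem theorem1p3 (N : nat) (a s : R)
  (hN : (1 <= N)%nat) (ha : 0 < a) (hs1 : s <> 1) (hs : 1 - 2 * INR N < s) :
  exists theta : R, 0 < theta < 1 /\
    hurwitz_remainder N (RtoC s) (RtoC a) =
    (RtoC (bernoulli (2 * N) / INR (fact (2 * N)))
     * (pochhammer (RtoC s) (2 * N - 1) / RtoC a ^ (2 * N))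
     * RtoC theta)%C.
Proof.
destruct N as [|M]; [lia|].
set (w := s - 1). assert (Hw : w <> 0) by (unfold w; lra).
assert (Hw' : 0 < w + INR (S (S (2 * M)))).
{ rewrite !S_INR, mult_INR. rewrite S_INR in hs. unfold w. simpl (INR 2). lra. }
destruct (em_remainder_fraction a M w ha Hw') as [theta [Htheta Hfrac]].
exists theta. split; [exact Htheta|].
change (hurwitz_remainder (S M) (RtoC s) (RtoC a) =
  (em_term (RtoC s) (RtoC a) (S M) * RtoC theta)%C).
replace s with (1 + w) by (unfold w; ring).
rewrite hurwitz_remainder_real, em_term_RtoC, <- RtoC_mult by easy. f_equal.
rewrite Hfrac, power_diff_em_term by easy.
pose proof (Rpower_pos a (- w)). field. lra.
Qed.
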